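(* Let $m\ge 1$ and $A\subseteq S^m$. Then $A$ is the set of divergence of some sequence $(G_n)$ of orientation-preserving Möbius maps acting on $S^m$ if and only if $A$ is the conical limit set $\Lambda_c(E)$ of some subset $E\subseteq H^{m+1}$.
   Context: $H^{m+1}$ denotes $(m+1)$-dimensional hyperbolic space with hyperbolic distance $\rho$, and $S^m=\partial H^{m+1}$ its ideal boundary sphere (in the Poincaré ball model, the unit sphere bounding the open unit ball). Möbius maps acting on $S^m$ extend uniquely to isometries of $H^{m+1}$; the orientation-preserving ones correspond to $\mathrm{Isom}^+(H^{m+1})$. The set of divergence of a sequence $(G_n)$ in $\mathrm{Isom}^+(H^{m+1})$ is the set of all $z\in S^m$ for which the sequence $(G_n(z))$ does not converge in $S^m$. A sequence $(z_n)$ in $H^{m+1}$ converges ideally to $x\in S^m$ if it converges to $x$ in the Euclidean topology of the closed unit ball (ball model). It converges conically to $x\in S^m$ if it converges ideally to $x$ and there is a geodesic ray $\gamma$ in $H^{m+1}$ landing at $x$ such that the distances $\rho(z_n,\gamma)$ are bounded. For $E\subseteq H^{m+1}$, the conical limit set $\Lambda_c(E)$ is the set of all $x\in S^m$ for which there is a sequence of points of $E$ converging conically to $x$. *)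

(* Defs.v *)
From mathcomp Require Import all_boot all_order all_algebra.
From mathcomp Require Import all_classical all_reals all_analysis.
Import Order.TTheory GRing.Theory Num.Theory.
Import numFieldNormedType.Exports.

Set Implicit Arguments.
Unset Strict Implicit.
Unset Printing Implicit Defensive.

Local Open Scope classical_set_scope.
Local Open Scope ring_scope.

Section BallModel.
Context {R : realType} {n : nat}.
Implicit Types x y a u : 'rV[R]_n.

(* The library norm `|x| on row vectors is the sup norm, hence [enorm]; both
   norms induce the topology used below for convergence. *)
Definition dotp x y : R := \sum_(i < n) x 0 i * y 0 i.
Definition enorm x : R := Num.sqrt (dotp x x).

Definition sphere : set 'rV[R]_n := [set x | enorm x = 1].
Definition hball : set 'rV[R]_n := [set x | enorm x < 1].

Definition arcosh (t : R) : R := ln (t + Num.sqrt (t ^+ 2 - 1)).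

(* The distance of the metric 2 |dx| / (1 - |x|^2), of curvature -1. *)
Definition hdist x y : R :=
  arcosh (1 + 2 * enorm (x - y) ^+ 2
                / ((1 - enorm x ^+ 2) * (1 - enorm y ^+ 2))).

(* The centre a should go to infinity; it goes to itself here. For spheres
   orthogonal to the unit sphere, a lies outside the closed unit ball, and
   the closed unit ball is mapped to itself. *)
Definition inversion a (r : R) x : 'rV[R]_n :=
  a + (r ^+ 2 / enorm (x - a) ^+ 2) *: (x - a).

Definition hyperplane_reflection u x : 'rV[R]_n := x - (2 * dotp x u) *: u.

(* The reflections in the codimension-one subspheres of the unit sphere,
   extended to the ball: such a subsphere is cut out either by a sphere
   orthogonal to the unit sphere or by a hyperplane through the origin. *)
Inductive sphere_reflection : ('rV[R]_n -> 'rV[R]_n) -> Prop :=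
| SphereInversion a (r : R) :
    0 < r -> enorm a ^+ 2 = 1 + r ^+ 2 -> sphere_reflection (inversion a r)
| HyperplaneReflection u :
    enorm u = 1 -> sphere_reflection (hyperplane_reflection u).

Inductive mobius : ('rV[R]_n -> 'rV[R]_n) -> Prop :=
| MobiusId : mobius id
| MobiusComp s f : sphere_reflection s -> mobius f -> mobius (s \o f).

Definition orientation_preserving (f : 'rV[R]_n -> 'rV[R]_n) : Prop :=
  forall x, hball x -> 0 < \det (jacobian f x).

Definition divergence_set (G : nat -> 'rV[R]_n -> 'rV[R]_n) : set 'rV[R]_n :=
  [set z | sphere z /\
    ~ exists2 w, sphere w & G k z @[k --> \oo] --> w].

(* Unit-speed rays, parametrised by [0, +oo[; values at negative reals are
   irrelevant. *)
Definition geodesic_ray (g : R -> 'rV[R]_n) : Prop :=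
  (forall t, 0 <= t -> hball (g t)) /\
  (forall s t, 0 <= s -> 0 <= t -> hdist (g s) (g t) = `|s - t|).

Definition lands_at (g : R -> 'rV[R]_n) x : Prop := g t @[t --> +oo] --> x.

Definition hdist_ray y (g : R -> 'rV[R]_n) : R :=
  inf [set hdist y (g t) | t in `[0, +oo[%classic].

Definition converges_ideally (z : nat -> 'rV[R]_n) x : Prop :=
  z k @[k --> \oo] --> x.

Definition converges_conically (z : nat -> 'rV[R]_n) x : Prop :=
  converges_ideally z x /\
  exists g : R -> 'rV[R]_n, [/\ geodesic_ray g, lands_at g x &
    exists M : R, forall k, hdist_ray (z k) g <= M].

Definition conical_limit_set (E : set 'rV[R]_n) : set 'rV[R]_n :=
  [set x | sphere x /\
    exists z : nat -> 'rV[R]_n, (forall k, E (z k)) /\ converges_conically z x].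

End BallModel.

Arguments sphere R n : clear implicits.
Arguments hball R n : clear implicits.

(* Main.v *)
From HB Require Import structures.
Require Import Defs.
From mathcomp Require Import all_boot all_order all_algebra.
From mathcomp Require Import all_classical all_reals all_analysis.
From mathcomp Require Import ring lra zify.
Import Order.TTheory GRing.Theory Num.Theory.
Import numFieldNormedType.Exports.

Set Implicit Arguments.
Unset Strict Implicit.
Unset Printing Implicit Defensive.

Local Open Scope classical_set_scope.
Local Open Scope ring_scope.

(** For [z] in the ball write [depth z] for [1 - |z| ^ 2]. Everything rests on two
    reductions to Euclidean estimates.

    The first is [conical_limit_setP]: [x] is a conical limit point of [E] exactly
    when, for some [M], there are points [z] of [E] of arbitrarily small depth with
    [|z - x| <= M * depth z]. The Busemann function of the landing point shows that
    every geodesic ray stays in such a Euclidean cone ([ray_in_cone]), and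
    conversely the cone is a bounded hyperbolic neighbourhood of the radial ray.
    Deleting from [E] the horoballs based at the points of a closed set [C] then
    deletes [C] from the conical limit set ([closed_conical]).

    The second is [mobius_chord]: if a Moebius map [f] sends [z] to the centre then
    [|f x - f y| = depth z * |x - y| / (|z - x| * |z - y|)] on the sphere. With
    [cone_ratio z x = depth z / |z - x|] this gives both the upper bound
    [cone_ratio z x + cone_ratio z y] and, for distinct [x] and [y], a lower bound
    proportional to [cone_ratio z x]. So [x] and [y] are brought together when [z]
    lies outside a wide cone at each of them, and are kept apart when [z] lies in a
    fixed cone at [x].

    From divergence to conical limits. Let [G k] send [z k] to the centre, and let
    [L] be the conical limit set of the [z k]. If three points converge to distinct
    limits, the [z k] stay in a compact part of the ball, the maps are
    equicontinuous, and the convergence set is closed. If at most two points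
    converge, it is closed as well. Otherwise the [z k] tend to the sphere; points
    outside [L] have asymptotic images, and a point of [L] never shares its limit
    with another point, so that the convergence set is the complement of [L]
    together with at most two points of [L]. In all cases the divergence set is the
    sphere, or [L], with a closed set removed ([divergence_dichotomy]).

    From conical limits to divergence. After a discretisation, [E] becomes a
    sequence [z k] whose depth tends to 0. Interleave it with a sequence that
    tends to the sphere along a horosphere, and so has no conical limit point. Take
    [G k] sending [z k] to the centre and the antipode of [z k / |z k|] to a fixed
    point [e1] of the sphere. Then [G k x] tends to [e1] if [x] is not a conical
    limit point. Otherwise it stays away from [e1] along the conical subsequence
    but tends to [e1] along the horosphere, so it diverges. Each such [G k] is an
    inversion followed by one reflection, hence preserves the orientation. *)

(** * Euclidean norm *)

Section EuclideanNorm.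
Context {R : realType} {n : nat}.
Implicit Types x y z : 'rV[R]_n.

Lemma dotpC x y : dotp x y = dotp y x.
Proof. by apply: eq_bigr => i _; rewrite mulrC. Qed.

Lemma dotpDl x y z : dotp (x + y) z = dotp x z + dotp y z.
Proof. by rewrite /dotp -big_split; apply: eq_bigr => i _; rewrite mxE mulrDl. Qed.

Lemma dotpDr x y z : dotp z (x + y) = dotp z x + dotp z y.
Proof. by rewrite dotpC dotpDl !(dotpC z). Qed.

Lemma dotpZl k x y : dotp (k *: x) y = k * dotp x y.
Proof. by rewrite /dotp mulr_sumr; apply: eq_bigr => i _; rewrite mxE mulrA. Qed.

Lemma dotpZr k x y : dotp x (k *: y) = k * dotp x y.
Proof. by rewrite dotpC dotpZl dotpC. Qed.

Lemma dotpNl x y : dotp (- x) y = - dotp x y.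
Proof. by rewrite -scaleN1r dotpZl mulN1r. Qed.

Lemma dotpNr x y : dotp x (- y) = - dotp x y.
Proof. by rewrite dotpC dotpNl dotpC. Qed.

Definition dotpE := (dotpDl, dotpDr, dotpZl, dotpZr, dotpNl, dotpNr).

Lemma dotp_ge0 x : 0 <= dotp x x.
Proof. by apply: sumr_ge0 => i _; rewrite -expr2 sqr_ge0. Qed.

Lemma sqr_enorm x : enorm x ^+ 2 = dotp x x.
Proof. by rewrite sqr_sqrtr ?dotp_ge0. Qed.

Lemma enorm_ge0 x : 0 <= enorm x.
Proof. exact: sqrtr_ge0. Qed.

Lemma enorm0 : enorm (0 : 'rV[R]_n) = 0.
Proof.
by rewrite /enorm /dotp big1 ?sqrtr0 // => i _; rewrite mxE mul0r.
Qed.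

Lemma enorm_eq0 x : (enorm x == 0) = (x == 0).
Proof.
apply/eqP/eqP => [x0|->]; last exact: enorm0.
have: dotp x x = 0 by rewrite -sqr_enorm x0 expr0n.
move/eqP; rewrite /dotp psumr_eq0 => [/allP h|i _]; last by rewrite -expr2 sqr_ge0.
apply/rowP => i; rewrite mxE; apply/eqP.
by have := h i (mem_index_enum i); rewrite -expr2 sqrf_eq0.
Qed.

Lemma enorm_gt0 x : (0 < enorm x) = (x != 0).
Proof. by rewrite lt_neqAle enorm_ge0 andbT eq_sym enorm_eq0. Qed.

Lemma enormZ k x : enorm (k *: x) = `|k| * enorm x.
Proof. by rewrite /enorm !dotpE mulrA -expr2 sqrtrM ?sqr_ge0 // sqrtr_sqr. Qed.

Lemma enormN x : enorm (- x) = enorm x.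
Proof. by rewrite /enorm !dotpE opprK. Qed.

Lemma enorm_subC x y : enorm (x - y) = enorm (y - x).
Proof. by rewrite -enormN opprB. Qed.

Lemma sqr_enorm_sub x y :
  enorm (x - y) ^+ 2 = enorm x ^+ 2 + enorm y ^+ 2 - 2 * dotp x y.
Proof. by rewrite !sqr_enorm !dotpE (dotpC y x); ring. Qed.

Lemma dotp_le x y : dotp x y <= enorm x * enorm y.
Proof.
have [->|x0] := eqVneq x 0.
  rewrite enorm0 mul0r /dotp big1 // => i _; first by rewrite mxE mul0r.
have [->|y0] := eqVneq y 0.
  rewrite enorm0 mulr0 /dotp big1 // => i _; first by rewrite mxE mulr0.
have nx : 0 < enorm x by rewrite enorm_gt0.
have ny : 0 < enorm y by rewrite enorm_gt0.
have := dotp_ge0 (enorm y *: x - enorm x *: y).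
rewrite !dotpE -!sqr_enorm (dotpC y x) => h.
have {}h : 0 <= 2 * (enorm x * enorm y) * (enorm x * enorm y - dotp x y).
  by apply: le_trans h _; rewrite le_eqVlt; apply/orP; left; apply/eqP; ring.
by move: h; rewrite pmulr_rge0 ?subr_ge0 // !mulr_gt0.
Qed.

Lemma enormD x y : enorm (x + y) <= enorm x + enorm y.
Proof.
rewrite -(@ler_pXn2r _ 2) ?nnegrE ?addr_ge0 ?enorm_ge0 //.
rewrite sqr_enorm !dotpE -!sqr_enorm (dotpC y x).
by have := dotp_le x y; nra.
Qed.

Lemma enorm_triangle y x z : enorm (x - z) <= enorm (x - y) + enorm (y - z).
Proof. by apply: le_trans (enormD _ _); rewrite addrA subrK. Qed.

Lemma enorm_rtriangle x y : enorm x - enorm y <= enorm (x - y).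
Proof. by rewrite lerBlDr; apply: le_trans (enormD _ _); rewrite subrK. Qed.

Lemma enorm_lipschitz z x y : `|enorm (z - x) - enorm (z - y)| <= enorm (x - y).
Proof.
have := enorm_triangle y z x; have := enorm_triangle x z y.
by rewrite (enorm_subC y x) ler_norml => h1 h2; apply/andP; split; lra.
Qed.

Lemma mx_norm_le_enorm x : `|x| <= enorm x.
Proof.
have [->|x0] := eqVneq x 0; first by rewrite normr0 enorm0.
have : mx_norm x != 0 by rewrite -[mx_norm x]/(`|x|) normr_eq0.
move=> /mx_norm_neq0 [[i j]]; rewrite -[mx_norm x]/(`|x|) => -> /=.
rewrite ord1 -sqrtr_sqr ler_wsqrtr // /dotp (bigD1 j) //= -expr2 lerDl.
by apply: sumr_ge0 => k _; rewrite -expr2 sqr_ge0.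
Qed.

Lemma coord_le_mx_norm x i : `|x 0 i| <= `|x|.
Proof.
rewrite [leRHS]/Num.norm /= mx_normrE; apply/bigmax_geP; right => /=.
by exists (0, i).
Qed.

Lemma enorm_le_mx_norm x : enorm x <= n%:R * `|x|.
Proof.
rewrite -(ger0_norm (mulr_ge0 (ler0n R n) (normr_ge0 x))) -sqrtr_sqr ler_wsqrtr //.
have : dotp x x <= \sum_(i < n) `|x| ^+ 2.
  apply: ler_sum => i _; rewrite -expr2 -real_normK ?num_real //.
  by rewrite lerXn2r ?nnegrE // coord_le_mx_norm.
rewrite sumr_const card_ord -[X in _ <= X -> _]mulr_natl exprMn => /le_trans; apply.
rewrite ler_wpM2r ?sqr_ge0 // -natrX ler_nat.
by case: n => // k; rewrite expnS leq_pmulr // expn1.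
Qed.

Lemma cvg_enormP (u : nat -> 'rV[R]_n) x :
  (u k @[k --> \oo] --> x) <->
  (forall e, 0 < e -> exists N, forall k, (N <= k)%N -> enorm (u k - x) < e).
Proof.
split=> [/cvgrPdist_lt ux e e0|ux].
  have n0 : 0 < n.+1%:R :> R by rewrite ltr0n.
  have [N _ uN] := ux _ (divr_gt0 e0 n0); exists N => k Nk.
  have := uN k Nk; rewrite /= distrC ltr_pdivlMr // => h.
  apply: le_lt_trans (enorm_le_mx_norm _) _; apply: le_lt_trans h.
  by rewrite mulrC ler_wpM2l // ler_nat.
apply/cvgrPdist_lt => e /ux [N uN]; exists N => // k Nk.
by rewrite distrC; apply: le_lt_trans (mx_norm_le_enorm _) (uN k Nk).
Qed.

Lemma cvg_pinfty_enorm (g : R -> 'rV[R]_n) x :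
  (g t @[t --> +oo] --> x) <->
  (forall e, 0 < e -> exists T, forall t, T < t -> enorm (g t - x) < e).
Proof.
split=> [/cvgrPdist_lt gx e e0|gx].
  have n0 : 0 < n.+1%:R :> R by rewrite ltr0n.
  have [T [_ gT]] := gx _ (divr_gt0 e0 n0); exists T => t Tt.
  have := gT t Tt; rewrite /= distrC ltr_pdivlMr // => h.
  apply: le_lt_trans (enorm_le_mx_norm _) _; apply: le_lt_trans h.
  by rewrite mulrC ler_wpM2l // ler_nat.
apply/cvgrPdist_lt => e /gx [T gT]; exists T; split; first exact: num_real.
move=> t Tt.
by rewrite distrC; apply: le_lt_trans (mx_norm_le_enorm _) (gT t Tt).
Qed.

End EuclideanNorm.

(** * Hyperbolic distance and conical convergence *)

Section HyperbolicDistance.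
Context {R : realType} {n : nat}.
Implicit Types (x y z : 'rV[R]_n) (u t : R) (E : set 'rV[R]_n).

(** Up to bounded factors, [exp] of minus the hyperbolic distance to the
    origin. *)
Definition depth x : R := 1 - enorm x ^+ 2.

Lemma depth_gt0 x : (0 < depth x) = (enorm x < 1).
Proof. by rewrite subr_gt0 expr_lt1 ?enorm_ge0. Qed.

Lemma depth_le1 x : depth x <= 1.
Proof. by rewrite lerBlDr lerDl sqr_ge0. Qed.

Lemma hball_depth x : hball R n x -> 0 < depth x.
Proof. by rewrite depth_gt0. Qed.

Lemma expR_arcosh u : 1 <= u -> expR (arcosh u) = u + Num.sqrt (u ^+ 2 - 1).
Proof.
by move=> u1; rewrite lnK // posrE ltr_wpDr ?sqrtr_ge0 // (lt_le_trans ltr01).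
Qed.

Lemma arcosh_ge0 u : 1 <= u -> 0 <= arcosh u.
Proof. by move=> u1; rewrite ln_ge0 // ler_wpDr ?sqrtr_ge0. Qed.

Lemma cosh_arcosh u : 1 <= u -> expR (arcosh u) + expR (- arcosh u) = 2 * u.
Proof.
move=> u1; rewrite expRN expR_arcosh //.
have q0 : 0 <= u ^+ 2 - 1 by nra.
have := sqr_sqrtr q0; have := sqrtr_ge0 (u ^+ 2 - 1).
set s := Num.sqrt _ => s0 sE.
have v0 : u + s != 0 by rewrite gt_eqF //; lra.
apply: (mulIf v0); rewrite mulrDl mulVf //; nra.
Qed.

Lemma arcosh_cosh t : 0 <= t -> arcosh ((expR t + expR (- t)) / 2) = t.
Proof.
move=> t0; rewrite /arcosh.
have e0 := expR_gt0 t; have e1 : 1 <= expR t by rewrite -expR0 ler_expR.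
have -> : ((expR t + expR (- t)) / 2) ^+ 2 - 1 = ((expR t - expR (- t)) / 2) ^+ 2.
  by rewrite expRN; field; rewrite gt_eqF.
rewrite sqrtr_sqr ger0_norm; last first.
  rewrite divr_ge0 // subr_ge0 ler_expR; lra.
rewrite [X in ln X](_ : _ = expR t) ?expRK //; first by field.
Qed.

Lemma hdistC x y : hdist x y = hdist y x.
Proof. by rewrite /hdist enorm_subC (mulrC (1 - enorm x ^+ 2)). Qed.

Lemma hdist_arg_ge1 x y : hball R n x -> hball R n y ->
  1 <= 1 + 2 * enorm (x - y) ^+ 2 / (depth x * depth y).
Proof.
move=> /hball_depth/ltW dx /hball_depth/ltW dy.
by rewrite lerDl divr_ge0 // mulr_ge0 ?sqr_ge0.
Qed.

Lemma hdist_ge0 x y : hball R n x -> hball R n y -> 0 <= hdist x y.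
Proof. by move=> hx hy; rewrite arcosh_ge0 // hdist_arg_ge1. Qed.

(** The law [4 sinh (h / 2) ^ 2 = 4 |x - y| ^ 2 / (depth x * depth y)] for the
    hyperbolic distance [h], cleared of denominators. *)
Lemma hdistP x y : hball R n x -> hball R n y ->
  4 * enorm (x - y) ^+ 2 =
  (expR (hdist x y) + expR (- hdist x y) - 2) * (depth x * depth y).
Proof.
move=> hx hy; have [dx dy] := (hball_depth hx, hball_depth hy).
rewrite cosh_arcosh; last exact: hdist_arg_ge1.
by rewrite -/(depth x) -/(depth y); field; rewrite !gt_eqF.
Qed.

Lemma hdist_eq x y t : hball R n x -> hball R n y -> 0 <= t ->
  4 * enorm (x - y) ^+ 2 = (expR t + expR (- t) - 2) * (depth x * depth y) ->
  hdist x y = t.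
Proof.
move=> /hball_depth dx /hball_depth dy t0 h.
rewrite /hdist -/(depth x) -/(depth y) -[RHS]arcosh_cosh //; congr arcosh.
have -> : 2 * enorm (x - y) ^+ 2 = 4 * enorm (x - y) ^+ 2 / 2 by field.
by rewrite h; field; rewrite !gt_eqF.
Qed.

Lemma hdist_bound x y t : hball R n x -> hball R n y -> hdist x y <= t ->
  4 * enorm (x - y) ^+ 2 <= expR t * (depth x * depth y).
Proof.
move=> hx hy ht; have [dx dy] := (hball_depth hx, hball_depth hy).
rewrite hdistP // ler_wpM2r ?mulr_ge0 ?ltW //.
have h0 := hdist_ge0 hx hy.
have : expR (hdist x y) <= expR t by rewrite ler_expR.
have : expR (- hdist x y) <= 1 by rewrite -expR0 ler_expR; lra.
by lra.
Qed.

(** In the limit [t -> +oo] this says that the Busemann function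
    [|g s - x| ^ 2 / depth (g s)] of the landing point decreases like
    [exp (- s)] along the ray. *)
Lemma ray_chord_decay (g : R -> 'rV[R]_n) s t : geodesic_ray g -> 0 <= s <= t ->
  depth (g 0) * enorm (g s - g t) ^+ 2 <=
  depth (g s) * expR (- s) * enorm (g 0 - g t) ^+ 2.
Proof.
move=> [gb gi] /andP[s0 st]; have t0 := le_trans s0 st.
have bs := gb _ s0; have bt := gb _ t0; have b0 := gb _ (lexx 0).
have ds := hball_depth bs; have dt := hball_depth bt; have d0 := hball_depth b0.
have h1 := hdistP bs bt; have h2 := hdistP b0 bt.
rewrite gi // distrC ger0_norm ?subr_ge0 // in h1.
rewrite gi // distrC subr0 ger0_norm // in h2.
have -> : depth (g 0) * enorm (g s - g t) ^+ 2 =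
          depth (g 0) * (4 * enorm (g s - g t) ^+ 2) / 4 by field.
have -> : depth (g s) * expR (- s) * enorm (g 0 - g t) ^+ 2 =
          depth (g s) * expR (- s) * (4 * enorm (g 0 - g t) ^+ 2) / 4 by field.
rewrite h1 h2 ler_wpM2r //.
have -> : depth (g 0) * ((expR (t - s) + expR (- (t - s)) - 2) *
            (depth (g s) * depth (g t))) =
   (expR (t - s) + expR (- (t - s)) - 2) *
   (depth (g 0) * depth (g s) * depth (g t)) by ring.
have -> : depth (g s) * expR (- s) *
            ((expR t + expR (- t) - 2) * (depth (g 0) * depth (g t))) =
   expR (- s) * (expR t + expR (- t) - 2) *
   (depth (g 0) * depth (g s) * depth (g t)) by ring.
rewrite ler_pM2r ?mulr_gt0 //.
rewrite opprB expRD (expRD s).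
have := expRxMexpNx_1 s; have := expRxMexpNx_1 t.
have : 1 <= expR s by rewrite -expR0 ler_expR.
have : 0 < expR (- s) by exact: expR_gt0.
have : expR (- t) <= expR (- s) by rewrite ler_expR lerN2.
have : 0 < expR (- t) by exact: expR_gt0.
have : expR s <= expR t by rewrite ler_expR.
have := expR_gt0 t.
move: (expR s) (expR t) (expR (- s)) (expR (- t)) => a b a' b'.
move=> b0' ab b'0 ba' a'0 a1 bE aE.
(* the difference of the two sides is (1 - a') (2 - (1 + a) b') *)
have cE : a' * a * b' = b' by rewrite (mulrC a') aE mul1r.
have ab' : a * b' <= 1 by rewrite -aE ler_wpM2l //; lra.
have a'1 : a' <= 1 by nra.
rewrite -subr_ge0 (_ : _ - _ = (1 - a') * (2 - (1 + a) * b') - (a' * a * b' - b'));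
  last by ring.
rewrite cE subrr subr0.
by apply: mulr_ge0; lra.
Qed.

Lemma ray_busemann (g : R -> 'rV[R]_n) x s : geodesic_ray g -> lands_at g x ->
  0 <= s ->
  depth (g 0) * enorm (g s - x) ^+ 2 <=
  depth (g s) * expR (- s) * enorm (g 0 - x) ^+ 2.
Proof.
move=> gr gx s0; have [gb gi] := gr.
have cn (p : 'rV[R]_n) : enorm (p - g t) @[t --> +oo] --> enorm (p - x).
  apply/cvgrPdist_lt => e e0; have [T hT] := (cvg_pinfty_enorm _ _).1 gx _ e0.
  exists T; split; first exact: num_real.
  by move=> t /hT; apply: le_lt_trans; rewrite distrC; apply: enorm_lipschitz.
have cv (p : 'rV[R]_n) k :
    k * enorm (p - g t) ^+ 2 @[t --> +oo] --> k * enorm (p - x) ^+ 2.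
  by apply: cvgM; [exact: cvg_cst | exact: cvgM].
apply: (ler_cvg_to (cv (g s) _) (cv (g 0) _)).
exists s; split; first exact: num_real.
by move=> t st; apply: ray_chord_decay => //; rewrite s0 ltW.
Qed.

(** A ray stays in a Euclidean cone at its landing point: its depth cannot
    decay faster than [exp (- t)], since it has unit speed, and the Busemann
    estimate turns this into a bound on [|g t - x|]. *)
Lemma ray_in_cone (g : R -> 'rV[R]_n) x :
  geodesic_ray g -> lands_at g x ->
  exists Q, forall t, 0 <= t -> enorm (g t - x) <= Q * depth (g t).
Proof.
move=> gr gx; have [gb gi] := gr; have b0 := gb _ (lexx 0).
have d0 := hball_depth b0; set c := enorm (g 0 - x) ^+ 2.
have c0 : 0 <= c by exact: sqr_ge0.
pose K := 1 / 2 + 2 * c / depth (g 0) ^+ 2.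
have K0 : 0 <= K by rewrite addr_ge0 // divr_ge0 ?sqr_ge0 // mulr_ge0.
exists (1 + K) => t t0; have bt := gb _ t0; have dt := hball_depth bt.
have hB := ray_busemann gr gx t0; rewrite -/c in hB.
have hH : 4 * enorm (g 0 - g t) ^+ 2 <= expR t * (depth (g 0) * depth (g t)).
  by apply: hdist_bound => //; rewrite gi // distrC subr0 ger0_norm.
have hT : c <= 2 * enorm (g 0 - g t) ^+ 2 + 2 * enorm (g t - x) ^+ 2.
  have := enorm_triangle (g t) (g 0) x; rewrite /c.
  move: (enorm_ge0 (g 0 - x)) (sqr_ge0 (enorm (g 0 - g t) - enorm (g t - x))).
  move: (enorm _) (enorm _) (enorm _) => w a b w0 ab wab; nra.
have e0 := expR_gt0 t; have e'0 := expR_gt0 (- t); have eE := expRxMexpNx_1 t.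
have e'1 : expR (- t) <= 1 by rewrite -expR0 ler_expR; lra.
have : enorm (g t - x) ^+ 2 <= K * depth (g t) ^+ 2.
  move: hB hH hT; rewrite /K.
  move: (enorm (g t - x) ^+ 2) (enorm (g 0 - g t) ^+ 2) => X Y.
  move: (expR t) (expR (- t)) e0 e'0 eE e'1 => a b.
  move: (depth (g 0)) (depth (g t)) d0 dt => p q p0 q0 a0 b0' ab b1 hB hH hT.
  have h1 : b * c <= q * (p / 2 + 2 * c / p).
    have : b * c <= b * (a * (p * q) / 2 + 2 * (q * b * c / p)).
      rewrite ler_pM2l //.
      have : X <= q * b * c / p by rewrite ler_pdivlMr // mulrC.
      lra.
    move=> /le_trans; apply.
    have -> : b * (a * (p * q) / 2 + 2 * (q * b * c / p)) =
      (a * b) * (p * q / 2) + (b * b) * (2 * (q * c / p)) by ring.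
    rewrite ab mulrDr.
    have -> : q * (2 * c / p) = 1 * (2 * (q * c / p)) by ring.
    have -> : q * (p / 2) = 1 * (p * q / 2) by ring.
    rewrite lerD2l; apply: ler_wpM2r; last by nra.
    by rewrite mulr_ge0 // divr_ge0 ?(ltW p0) // mulr_ge0 ?(ltW q0).
  have h2 : X <= q * (b * c) / p by rewrite ler_pdivlMr // mulrC mulrA.
  apply: le_trans h2 _; rewrite ler_pdivrMr //.
  apply: le_trans (ler_wpM2l (ltW q0) h1) _.
  rewrite le_eqVlt; apply/orP; left; apply/eqP; field; lra.
clearbody K; have := enorm_ge0 (g t - x); move: (enorm _) (depth (g t)) dt => X q q0 X0 h.
rewrite -(@ler_pXn2r _ 2) ?nnegrE ?mulr_ge0 ?addr_ge0 ?(ltW q0) //.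
apply: le_trans h _; rewrite exprMn ler_wpM2r ?sqr_ge0 //; nra.
Qed.

(** Within bounded hyperbolic distance both the depth and the Euclidean
    distance to [x], measured in units of depth, change by bounded factors. *)
Lemma cone_hdist x y z Q t : hball R n y -> hball R n z -> 0 <= Q ->
  enorm (y - x) <= Q * depth y -> hdist z y <= t ->
  enorm (z - x) <= (expR t + 1 + Q * (2 * expR t + 3)) * depth z.
Proof.
move=> hy hz Q0 hQ ht; have := hdist_bound hz hy ht.
have dy := hball_depth hy; have dz := hball_depth hz; have e0 := expR_gt0 t.
have dyz : depth y <= depth z + 2 * enorm (z - y).
  have := enorm_rtriangle z y; rewrite /depth.
  move: hy hz (enorm_ge0 y) (enorm_ge0 z) (enorm_ge0 (z - y)).
  rewrite /hball /=; nra.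
have := enorm_triangle y z x; have := enorm_ge0 (z - y).
move: (enorm (z - y)) (enorm (y - x)) (enorm (z - x)) (expR t) e0 hQ dyz.
move: (depth y) (depth z) dy dz => p q p0 q0 w X Y K K0 hQ pq w0 hT hw.
have wq : w <= (K + 1) * q.
  rewrite leNgt; apply/negP => h.
  have : 4 * w ^+ 2 <= K * (q * (q + 2 * w)).
    apply: le_trans hw _; rewrite mulrC [leRHS]mulrC.
    by rewrite ler_pM2r // [leLHS]mulrC mulrC; nra.
  have : 0 < K * q by exact: mulr_gt0.
  nra.
have : p <= (2 * K + 3) * q by lra.
nra.
Qed.

End HyperbolicDistance.

Section ConicalPoints.
Context {R : realType} {n : nat}.
Implicit Types (x y z : 'rV[R]_n) (E C : set 'rV[R]_n).

(** Points of [E] inside one Euclidean cone at [x], arbitrarily close to the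
    sphere; by [conical_limit_setP] this is conical convergence with the
    geodesic rays eliminated. *)
Definition conical_point E x := exists M, forall e, 0 < e ->
  exists2 z, E z & enorm (z - x) <= M * depth z /\ depth z < e.

Lemma depth_le_dist x z : sphere R n x -> hball R n z ->
  depth z <= 2 * enorm (z - x).
Proof.
rewrite /sphere /hball /depth /= => sx hz.
have := enorm_rtriangle x z; rewrite enorm_subC sx.
by have := enorm_ge0 z; nra.
Qed.

Definition radial_ray x (t : R) : 'rV[R]_n := ((expR t - 1) / (expR t + 1)) *: x.

Lemma radial_enorm x k : sphere R n x -> 0 <= k -> enorm (k *: x) = k.
Proof. by move=> sx k0; rewrite enormZ ger0_norm // sx mulr1. Qed.

Lemma radial_ray_geodesic x : sphere R n x -> geodesic_ray (radial_ray x).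
Proof.
move=> sx; pose r (t : R) := (expR t - 1) / (expR t + 1).
have e1 t : 0 <= t -> 1 <= expR t by move=> t0; rewrite -expR0 ler_expR.
have r0 t : 0 <= t -> 0 <= r t.
  by move=> /e1 h; rewrite divr_ge0 ?subr_ge0 // addr_ge0 // expR_ge0.
have rb t : 0 <= t -> hball R n (radial_ray x t).
  move=> t0; rewrite /hball /= radial_enorm ?r0 //.
  by rewrite ltr_pdivrMr; have := expR_gt0 t; lra.
have rd t : 0 <= t -> depth (radial_ray x t) = 4 * expR t / (expR t + 1) ^+ 2.
  move=> t0; rewrite /depth radial_enorm ?r0 //; field.
  by have := expR_gt0 t; lra.
split=> // s t; wlog st : s t / s <= t => [hw s0 t0|s0 t0].
  have [st|/ltW ts] := leP s t; first exact: hw.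
  by rewrite distrC hdistC hw.
rewrite distrC ger0_norm ?subr_ge0 //; apply: hdist_eq; rewrite ?subr_ge0 //.
- exact: rb.
- exact: rb.
have es := expR_gt0 s; have et := expR_gt0 t.
rewrite !rd // -scalerBl enormZ sx mulr1 real_normK ?num_real //.
rewrite opprB !expRB; field; lra.
Qed.

Lemma radial_ray_lands x : sphere R n x -> lands_at (radial_ray x) x.
Proof.
move=> sx; apply/cvg_pinfty_enorm => e e0; exists (2 / e) => t te.
have et := expR_gt0 t; have := expR_ge1Dx t.
rewrite -[X in _ - X]scale1r -scalerBl enormZ sx mulr1 => he.
have -> : (expR t - 1) / (expR t + 1) - 1 = - (2 / (expR t + 1)) by field; lra.
rewrite normrN ger0_norm ?divr_ge0 ?addr_ge0 ?expR_ge0 //.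
rewrite ltr_pdivrMr; last lra.
by move: te; rewrite ltr_pdivrMr // => te; nra.
Qed.

Lemma hdist_le_ln x y (K : R) : hball R n x -> hball R n y -> 0 <= K ->
  4 * enorm (x - y) ^+ 2 <= K * (depth x * depth y) -> hdist x y <= ln (2 + K).
Proof.
move=> hx hy K0 hK; have [dx dy] := (hball_depth hx, hball_depth hy).
have e0 := expR_gt0 (- hdist x y).
rewrite -ler_expR lnK ?posrE; last lra.
rewrite hdistP // ler_pM2r ?mulr_gt0 // in hK; lra.
Qed.

Lemma hdist_ray_le z (g : R -> 'rV[R]_n) t : hball R n z -> geodesic_ray g ->
  0 <= t -> hdist_ray z g <= hdist z (g t).
Proof.
move=> hz [gb _] t0; apply: ge_inf; last by exists t; rewrite //= in_itv /= t0.
by exists 0 => y [s /=]; rewrite in_itv /= andbT => s0 <-; apply/hdist_ge0/gb.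
Qed.

Lemma hdist_ray_attained z (g : R -> 'rV[R]_n) M : hball R n z ->
  geodesic_ray g -> hdist_ray z g <= M ->
  exists2 t, 0 <= t & hdist z (g t) < M + 1.
Proof.
move=> hz [gb _] hM.
have [||_ [t /= t0 <-] h] := @inf_adherent R [set hdist z (g t) | t in `[0, +oo[] 1.
- exact: ltr01.
- split; first by exists (hdist z (g 0)); exists 0; rewrite //= in_itv /= lexx.
  by exists 0 => y [s /=]; rewrite in_itv /= andbT => s0 <-; apply/hdist_ge0/gb.
exists t; first by move: t0; rewrite in_itv /= andbT.
by apply: lt_le_trans h _; rewrite lerD2r.
Qed.

Lemma conical_limit_setP E x : E `<=` hball R n ->
  conical_limit_set E x <-> sphere R n x /\ conical_point E x.
Proof.
move=> EB; split=> [[sx [z [Ez [zx [g [gr gx [M hM]]]]]]]|[sx [M hM]]].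
  split=> //; have [Q hQ] := ray_in_cone gr gx.
  have Q0 : 0 <= Q.
    have := le_trans (enorm_ge0 _) (hQ 0 (lexx _)).
    by rewrite pmulr_lge0 //; apply/hball_depth/gr.1.
  exists (expR (M + 1) + 1 + Q * (2 * expR (M + 1) + 3)) => e e0.
  have [N hN] := (cvg_enormP _ _).1 zx _ (divr_gt0 e0 (ltr0n _ 2)).
  have bz := EB _ (Ez N); exists (z N) => //; split.
    have [t t0 /ltW ht] := hdist_ray_attained bz gr (hM N).
    exact: (cone_hdist (gr.1 _ t0) bz Q0 (hQ _ t0) ht).
  apply: le_lt_trans (depth_le_dist sx bz) _.
  by have := hN N (leqnn _); lra.
split=> //.
have /choice[z hz] (k : nat) : exists z,
    E z /\ enorm (z - x) <= M * depth z /\ depth z < k.+1%:R^-1.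
  have k0 : 0 < k.+1%:R^-1 :> R by rewrite invr_gt0 ltr0n.
  by have [z Ez hz] := hM _ k0; exists z.
have M0 : 0 <= M.
  have [Ez [h _]] := hz 0%N; have := le_trans (enorm_ge0 _) h.
  by rewrite pmulr_lge0 // hball_depth //; apply: EB.
exists z; split=> [k|]; first by have [] := hz k.
split.
  apply/cvg_enormP => e e0.
  have [N hN] : exists N : nat, (M + 1) / e < N%:R.
    by exists (Num.truncn ((M + 1) / e)).+1; apply: truncnS_gt.
  exists N => k Nk; have [Ez [h1 h2]] := hz k.
  have dz := hball_depth (EB _ Ez); apply: le_lt_trans h1 _.
  have k0 : 0 < k.+1%:R :> R by rewrite ltr0n.
  have hk : (M + 1) / e < k.+1%:R.
    by apply: lt_trans hN _; rewrite ltr_nat ltnS.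
  rewrite ltr_pdivrMr // in hk.
  rewrite -[k.+1%:R^-1]div1r ltr_pdivlMr // in h2; nra.
exists (radial_ray x); split; first exact: radial_ray_geodesic.
  exact: radial_ray_lands.
exists (ln (2 + 4 * (M + 1) ^+ 2)) => k; have [Ez [h1 h2]] := hz k.
have bz := EB _ Ez; have dz := hball_depth bz; have nz := enorm_ge0 (z k).
rewrite /hball /= in bz.
(* the point of the radial ray at the same Euclidean radius as [z k] *)
pose t := ln ((1 + enorm (z k)) / (1 - enorm (z k))).
have q1 : 1 <= (1 + enorm (z k)) / (1 - enorm (z k)).
  by rewrite ler_pdivlMr; lra.
have t0 : 0 <= t by rewrite ln_ge0.
have rE : radial_ray x t = enorm (z k) *: x.
  rewrite /radial_ray lnK ?posrE ?(lt_le_trans _ q1) //; congr (_ *: _).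
  by field; apply/andP; split; lra.
apply: le_trans (hdist_ray_le bz (radial_ray_geodesic sx) t0) _.
have gb := (radial_ray_geodesic sx).1 _ t0; move: gb; rewrite rE => gb.
apply: hdist_le_ln => //; first by rewrite mulr_ge0 ?sqr_ge0.
have dE : depth (enorm (z k) *: x) = depth (z k).
  by rewrite /depth radial_enorm.
rewrite dE -mulrA ler_pM2l // -expr2 -exprMn lerXn2r ?nnegrE ?enorm_ge0 //.
  by rewrite mulr_ge0 ?(ltW dz) // addr_ge0.
apply: le_trans (enorm_triangle x _ _) _; rewrite mulrDl mul1r lerD //.
rewrite -[X in X - _]scale1r -scalerBl enormZ sx mulr1 ger0_norm; last lra.
by rewrite /depth; nra.
Qed.

Lemma conical_pointS E1 E2 x :
  E1 `<=` E2 -> conical_point E1 x -> conical_point E2 x.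
Proof. by move=> s [M h]; exists M => e /h [z /s]; exists z. Qed.

(** The complement of horoballs based at the points of [C]. *)
Definition off_horoballs C : set 'rV[R]_n :=
  [set z | forall x, C x -> depth z <= enorm (z - x) ^+ 2].

(** A horoball at [x] contains the tip of every cone at [x], but only a
    bounded initial part of the cones at other points: deleting the horoballs
    at a closed set [C] deletes exactly [C] from the conical limit set. *)
Lemma conical_point_off_horoballs E C x : E `<=` hball R n -> closed C ->
  conical_point (E `&` off_horoballs C) x <-> conical_point E x /\ ~ C x.
Proof.
move=> EB clC; split=> [cx|[[M hM] nCx]].
  split; first by apply: conical_pointS cx => z [].
  move: cx => [M hM] Cx.
  have M0 : 0 < (1 + M ^+ 2)^-1 by rewrite invr_gt0 ltr_wpDr ?sqr_ge0.
  have [z [Ez hz] [h1 h2]] := hM _ M0.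
  have dz := hball_depth (EB _ Ez); have := hz _ Cx.
  have : enorm (z - x) ^+ 2 <= (M * depth z) ^+ 2.
    by rewrite lerXn2r ?nnegrE ?enorm_ge0 // (le_trans (enorm_ge0 _) h1).
  move: h2; rewrite -[_^-1]div1r ltr_pdivlMr ?ltr_wpDr ?sqr_ge0 // exprMn.
  move: (depth z) (enorm _ ^+ 2) dz (sqr_ge0 M) => d X d0; move: (M ^+ 2) => K K0.
  by move=> *; nra.
have [r r0 hr] : exists2 r, 0 < r & forall y, C y -> r <= enorm (x - y).
  have := closed_openC clC; rewrite openE => /(_ _ nCx) /nbhs_ballP[r r0 hr].
  exists r => // y Cy; rewrite leNgt; apply/negP => xy.
  apply: (hr y) Cy; rewrite -ball_normE /=.
  exact: le_lt_trans (mx_norm_le_enorm _) xy.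
exists M => e e0.
have M0 : 0 < 2 * (`|M| + 1) by have := normr_ge0 M; lra.
pose e' := Num.min e (Num.min (r / (2 * (`|M| + 1))) (r ^+ 2 / 4)).
have e'0 : 0 < e' by rewrite !lt_min e0 !divr_gt0 ?exprn_gt0.
have [z Ez [h1]] := hM _ e'0; rewrite !lt_min => /and3P[h2 h3 h4].
exists z => //; split=> // y Cy; apply: le_trans (ltW h4) _.
have dz := hball_depth (EB _ Ez).
have hy : r / 2 <= enorm (z - y).
  have := enorm_triangle z x y; have := hr _ Cy; rewrite (enorm_subC x z).
  move: h3; rewrite ltr_pdivlMr // => h3.
  by have := ler_norm M; have := normr_ge0 M; nra.
have -> : r ^+ 2 / 4 = (r / 2) ^+ 2 by field.
by rewrite lerXn2r ?nnegrE ?enorm_ge0 // divr_ge0 // ltW.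
Qed.

Lemma conical_point_hball x : sphere R n x -> conical_point (hball R n) x.
Proof.
move=> sx; exists 1 => e e0; pose k := Num.max 0 (1 - e / 3).
have k1 : k < 1 by rewrite gt_max; apply/andP; split; lra.
have ke : 1 - e / 3 <= k by rewrite le_max lexx orbT.
have k0 : 0 <= k by rewrite le_max lexx.
exists (k *: x); first by rewrite /hball /= radial_enorm.
rewrite -[X in _ - X]scale1r -scalerBl enormZ sx mulr1 distrC ger0_norm; last lra.
by rewrite /depth radial_enorm //; split; nra.
Qed.

Lemma closed_conical E C : E `<=` hball R n -> closed C ->
  exists2 E', E' `<=` hball R n &
    conical_limit_set E' = conical_limit_set E `\` C.
Proof.
move=> EB clC; exists (E `&` off_horoballs C); first by move=> z [/EB].
apply/seteqP; split=> x.
  rewrite conical_limit_setP => [[sx /conical_point_off_horoballs[]//]|z [/EB]//].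
  by move=> cx nCx; split=> //; rewrite conical_limit_setP.
move=> [/conical_limit_setP[]// sx cx nCx].
rewrite conical_limit_setP => [|z [/EB]//]; split=> //.
exact/conical_point_off_horoballs.
Qed.

Lemma conical_limit_hball : conical_limit_set (hball R n) = sphere R n.
Proof.
apply/seteqP; split=> x; first by case/conical_limit_setP.
by move=> sx; rewrite conical_limit_setP //; split=> //; apply: conical_point_hball.
Qed.

End ConicalPoints.

(** * Moebius maps acting on the closed ball *)

Section Mobius.
Context {R : realType} {n : nat}.
Implicit Types (x y z a u : 'rV[R]_n) (f s : 'rV[R]_n -> 'rV[R]_n) (r : R).

Lemma inversion_sub a r x :
  inversion a r x - a = (r ^+ 2 / enorm (x - a) ^+ 2) *: (x - a).
Proof. by rewrite /inversion addrC addKr. Qed.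

Lemma inversion_chord a r x y : x != a -> y != a ->
  enorm (inversion a r x - inversion a r y) ^+ 2 =
  r ^+ 2 / enorm (x - a) ^+ 2 * (r ^+ 2 / enorm (y - a) ^+ 2) * enorm (x - y) ^+ 2.
Proof.
rewrite -!(subr_eq0 _ a) -!enorm_eq0 => xa ya.
have -> : inversion a r x - inversion a r y =
    (inversion a r x - a) - (inversion a r y - a) by rewrite opprB addrA subrK.
have -> : enorm (x - y) = enorm ((x - a) - (y - a)) by rewrite opprB addrA subrK.
rewrite !inversion_sub (sqr_enorm_sub (x - a)) (sqr_enorm_sub (_ *: _)).
rewrite !enormZ dotpZl dotpZr !exprMn.
rewrite !real_normK ?num_real //.
by move: (enorm (x - a)) (enorm (y - a)) (dotp _ _) xa ya => p q d p0 q0; field;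
   rewrite p0 q0.
Qed.

Lemma inversion_depth a r x : enorm a ^+ 2 = 1 + r ^+ 2 -> x != a ->
  depth (inversion a r x) = r ^+ 2 / enorm (x - a) ^+ 2 * depth x.
Proof.
move=> ha; rewrite -(subr_eq0 _ a) -enorm_eq0 => xa.
have hx : enorm x ^+ 2 =
    enorm a ^+ 2 + 2 * dotp a (x - a) + enorm (x - a) ^+ 2.
  rewrite -{1}(subrK a x); move: (x - a) => w.
  by rewrite !sqr_enorm !dotpE (dotpC w a); ring.
rewrite /depth hx /inversion sqr_enorm !(dotpDl a) !(dotpDr a) !dotpZl !dotpZr.
rewrite (dotpC _ a) -!sqr_enorm ha.
by move: (enorm (x - a)) (dotp a _) xa => p d p0; field.
Qed.

Lemma inversionK a r x : 0 < r -> x != a -> inversion a r (inversion a r x) = x.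
Proof.
move=> r0; rewrite -(subr_eq0 _ a) -enorm_eq0 => xa.
rewrite {1}/inversion inversion_sub enormZ scalerA.
rewrite exprMn real_normK ?num_real //.
rewrite (_ : _ * _ = 1); first by rewrite scale1r addrC subrK.
by move: (enorm (x - a)) xa => p p0; field; rewrite p0 gt_eqF.
Qed.

Lemma reflectionE u x y : enorm u = 1 ->
  dotp (hyperplane_reflection u x) (hyperplane_reflection u y) = dotp x y.
Proof.
move=> hu; rewrite /hyperplane_reflection !dotpE -(sqr_enorm u) hu.
by rewrite (dotpC u y); ring.
Qed.

Lemma reflection_enorm u x : enorm u = 1 ->
  enorm (hyperplane_reflection u x) = enorm x.
Proof. by move=> hu; rewrite /enorm reflectionE. Qed.

Lemma reflection_sub u x y :
  hyperplane_reflection u x - hyperplane_reflection u y =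
  hyperplane_reflection u (x - y).
Proof.
by apply/rowP => i; rewrite !mxE !dotpE; ring.
Qed.

Lemma reflectionK u x : enorm u = 1 ->
  hyperplane_reflection u (hyperplane_reflection u x) = x.
Proof.
move=> hu; rewrite /hyperplane_reflection !dotpE -(sqr_enorm u) hu.
by apply/rowP => i; rewrite !mxE; ring.
Qed.

(** The function [lam] is the conformal factor of [f]; these two identities,
    unlike an explicit formula for [f], pass at once to compositions. *)
Definition conformal_on_ball f := exists lam : 'rV[R]_n -> R, forall x,
  enorm x <= 1 ->
  [/\ 0 < lam x, depth (f x) = lam x * depth x &
      forall y, enorm y <= 1 ->
        enorm (f x - f y) ^+ 2 = lam x * lam y * enorm (x - y) ^+ 2].

Lemma conformal_ball f x : conformal_on_ball f -> enorm x <= 1 -> enorm (f x) <= 1.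
Proof.
move=> [lam hlam] x1; have [l0 hd _] := hlam _ x1.
have : 0 <= depth (f x) by rewrite hd mulr_ge0 ?(ltW l0) // subr_ge0 expr_le1 ?enorm_ge0.
by rewrite subr_ge0 expr_le1 ?enorm_ge0.
Qed.

Lemma conformal_comp s f :
  conformal_on_ball s -> conformal_on_ball f -> conformal_on_ball (s \o f).
Proof.
move=> cs cf; have [ls hs] := cs; have [lf hf] := cf.
exists (fun x => ls (f x) * lf x) => x x1.
have fx1 := conformal_ball cf x1.
have [l1 d1 c1] := hs _ fx1; have [l2 d2 c2] := hf _ x1.
split; [exact: mulr_gt0 | by rewrite /= d1 d2 mulrA | move=> y y1].
by rewrite /= c1 ?conformal_ball // c2 //; ring.
Qed.

Lemma center_out a r x : 0 < r -> enorm a ^+ 2 = 1 + r ^+ 2 -> enorm x <= 1 -> x != a.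
Proof.
move=> r0 ha x1; apply: contraTneq x1 => ->; rewrite -ltNge.
by have := enorm_ge0 a; nra.
Qed.

Lemma sphere_reflection_conformal s : sphere_reflection s ->
  conformal_on_ball s /\ (forall x, enorm x <= 1 -> s (s x) = x).
Proof.
case=> [a r r0 ha|u hu]; last first.
  split; last by move=> x _; exact: reflectionK.
  exists (fun=> 1) => x _; rewrite /depth reflection_enorm // !mul1r.
  by split=> // y _; rewrite reflection_sub reflection_enorm // !mul1r.
have out x := center_out r0 ha (x := x).
split; last by move=> x x1; apply: inversionK => //; exact: out.
exists (fun x => r ^+ 2 / enorm (x - a) ^+ 2) => x x1.
split; last by move=> y y1; apply: inversion_chord; exact: out.
  by rewrite divr_gt0 ?exprn_gt0 ?enorm_gt0 ?subr_eq0 ?out.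
exact/inversion_depth/out.
Qed.

Lemma mobius_conformal f : mobius f -> conformal_on_ball f /\
  (forall y, enorm y <= 1 -> exists2 x, enorm x <= 1 & f x = y).
Proof.
elim=> [|s {}f hs _ [cf sf]].
  split=> [|y y1]; last by exists y.
  by exists (fun=> 1) => x x1; split=> [//||y y1]; rewrite !mul1r.
have [cs ss] := sphere_reflection_conformal hs.
split=> [|y y1]; first exact: conformal_comp.
have [x x1 fx] := sf _ (conformal_ball cs y1).
by exists x => //=; rewrite fx ss.
Qed.

Lemma mobius_sphere f x : mobius f -> sphere R n x -> sphere R n (f x).
Proof.
move=> /mobius_conformal[[lam hlam] _] sx.
have [|_ hd _] := hlam x; first by rewrite sx.
have : depth (f x) = 0 by rewrite hd /depth sx expr1n subrr mulr0.
move/eqP; rewrite subr_eq0 => /eqP h; apply/eqP.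
by rewrite -(@eqrXn2 _ 2) ?enorm_ge0 // -h expr1n.
Qed.

Lemma mobius_zero f : mobius f -> exists2 z, hball R n z & f z = 0.
Proof.
move=> /mobius_conformal[[lam hlam] sf].
have [|z z1 fz] := sf 0; first by rewrite enorm0.
exists z => //; have [l0 hd _] := hlam _ z1.
rewrite /hball /= -depth_gt0; move: hd.
by rewrite fz /depth enorm0 expr0n subr0 -/(depth z) => h; rewrite -(pmulr_rgt0 _ l0) -h.
Qed.

Lemma sphere_ball_neq x z : sphere R n x -> hball R n z -> 0 < enorm (z - x).
Proof.
move=> sx hz; rewrite enorm_gt0 subr_eq0; apply: contraTneq hz => ->.
by rewrite /hball /= sx ltxx.
Qed.

(** The conformal factor at a point of the sphere is the Poisson kernel of the
    point sent to the centre. *)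
Lemma mobius_chord f z x y : mobius f -> hball R n z -> f z = 0 ->
  sphere R n x -> sphere R n y ->
  enorm (f x - f y) =
    depth z * enorm (x - y) / (enorm (z - x) * enorm (z - y)).
Proof.
move=> mf hz fz sx sy; have [[lam hlam] _] := mobius_conformal mf.
have zx := sphere_ball_neq sx hz; have zy := sphere_ball_neq sy hz.
have dz := hball_depth hz.
have z1 : enorm z <= 1 by exact: ltW.
have [lz dE cz] := hlam _ z1.
have lzE : lam z = (depth z)^-1.
  apply: (mulIf (lt0r_neq0 dz)); rewrite mulVf ?gt_eqF // -dE fz.
  by rewrite /depth enorm0 expr0n subr0.
have poisson p : sphere R n p -> lam p = depth z / enorm (z - p) ^+ 2.
  move=> sp; have zp := sphere_ball_neq sp hz; have p1 : enorm p <= 1 by rewrite sp.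
  have := cz _ p1; rewrite fz sub0r enormN (mobius_sphere mf sp) expr1n lzE => h.
  apply: (mulIf (x := (depth z)^-1 * enorm (z - p) ^+ 2)).
    by rewrite mulf_neq0 ?invr_neq0 ?expf_neq0 ?gt_eqF.
  by rewrite mulrCA mulrA -h; field; rewrite !gt_eqF.
have x1 : enorm x <= 1 by rewrite sx.
have y1 : enorm y <= 1 by rewrite sy.
have [_ _ cx] := hlam _ x1.
apply/eqP; rewrite -(@eqrXn2 _ 2) ?enorm_ge0 //; last first.
  by rewrite divr_ge0 ?mulr_ge0 ?enorm_ge0 ?(ltW dz).
by rewrite cx // !poisson //; apply/eqP; field; rewrite !gt_eqF.
Qed.

(** The inverse of the aperture of the cone at [x] that [z] lies on. *)
Definition cone_ratio z x : R := depth z / enorm (z - x).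

Lemma mobius_chord_le f z x y : mobius f -> hball R n z -> f z = 0 ->
  sphere R n x -> sphere R n y ->
  enorm (f x - f y) <= cone_ratio z x + cone_ratio z y.
Proof.
move=> mf hz fz sx sy; rewrite (mobius_chord mf hz fz) //.
have zx := sphere_ball_neq sx hz; have zy := sphere_ball_neq sy hz.
rewrite /cone_ratio.
have -> : depth z / enorm (z - x) + depth z / enorm (z - y) =
  depth z * (enorm (x - z) + enorm (z - y)) / (enorm (z - x) * enorm (z - y)).
  by rewrite (enorm_subC x); field; rewrite !gt_eqF.
rewrite ler_wpM2r ?invr_ge0 ?mulr_ge0 ?enorm_ge0 //.
by rewrite ler_wpM2l ?(ltW (hball_depth hz)) // enorm_triangle.
Qed.

Lemma mobius_chord_ratio f z x y : mobius f -> hball R n z -> f z = 0 ->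
  sphere R n x -> sphere R n y ->
  enorm (f x - f y) = cone_ratio z x * (enorm (x - y) / enorm (z - y)).
Proof.
move=> mf hz fz sx sy; rewrite (mobius_chord mf hz fz) //.
have zx := sphere_ball_neq sx hz; have zy := sphere_ball_neq sy hz.
by rewrite /cone_ratio; field; rewrite !gt_eqF.
Qed.

End Mobius.

(** * Sequences of Moebius maps: from divergence to conical limits *)

Section Convergence.
Context {R : realType} {n : nat}.
Implicit Types (x y w : 'rV[R]_n) (C : set 'rV[R]_n) (u : nat -> 'rV[R]_n).

Lemma closure_enorm C x : closure C x ->
  forall e, 0 < e -> exists2 y, C y & enorm (x - y) < e.
Proof.
move=> clx e e0; have n0 : 0 < n.+1%:R :> R by rewrite ltr0n.
have [y [Cy]] := clx _ (nbhsx_ballx x _ (divr_gt0 e0 n0)).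
rewrite -ball_normE /= ltr_pdivlMr // => h; exists y => //.
apply: le_lt_trans (enorm_le_mx_norm _) _; apply: le_lt_trans h.
by rewrite mulrC ler_wpM2l // ler_nat.
Qed.

Lemma cauchy_enorm u :
  (forall e, 0 < e -> exists w N, forall k, (N <= k)%N -> enorm (u k - w) < e) ->
  exists w, u k @[k --> \oo] --> w.
Proof.
move=> uC; apply/cvg_ex/cauchy_cvgP/cauchy_exP => e e0.
have [w [N hN]] := uC _ e0; exists w; exists N => // k Nk.
rewrite -ball_normE /= distrC.
exact: le_lt_trans (mx_norm_le_enorm _) (hN _ Nk).
Qed.

Lemma sphere_approx x :
  (forall e, 0 < e -> exists2 y, sphere R n y & enorm (x - y) < e) ->
  sphere R n x.
Proof.
move=> apx; rewrite /sphere /=; apply/eqP; rewrite -subr_eq0 -normr_le0.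
apply/ler_addgt0Pl => e /apx[y sy /ltW]; rewrite addr0.
apply: le_trans; have := enorm_rtriangle x y; have := enorm_rtriangle y x.
by rewrite (enorm_subC y) sy => h1 h2; rewrite ler_norml lerNl opprB h1 h2.
Qed.

Lemma cvg_sphere u w : (forall k, sphere R n (u k)) ->
  u k @[k --> \oo] --> w -> sphere R n w.
Proof.
move=> su /cvg_enormP uw; apply: sphere_approx => e /uw[N /(_ _ (leqnn _)) h].
by exists (u N); rewrite // enorm_subC.
Qed.

(** Limits are unique in a quantitative form: if the terms of two convergent
    sequences are infinitely often [c] apart, the limits differ. *)
Lemma cvg_apart u v w w' (c : R) : 0 < c ->
  u k @[k --> \oo] --> w -> v k @[k --> \oo] --> w' ->
  (forall N, exists2 k, (N <= k)%N & c <= enorm (u k - v k)) -> w <> w'.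
Proof.
move=> c0 /cvg_enormP uw /cvg_enormP vw far ww'; rewrite -ww' in vw.
have c2 : 0 < c / 2 by rewrite divr_gt0.
have [N1 h1] := uw _ c2; have [N2 h2] := vw _ c2.
have [k] := far (maxn N1 N2); rewrite geq_max => /andP[k1 k2].
have := enorm_triangle w (u k) (v k); rewrite (enorm_subC w).
by have := h1 _ k1; have := h2 _ k2; lra.
Qed.

Definition no_three C := forall x y w, C x -> C y -> C w ->
  x <> y -> y <> w -> x <> w -> False.

Lemma no_three_closed C : no_three C -> closed C.
Proof.
move=> C3; apply: (iffLR (@accessible_finite_set_closed 'rV[R]_n)).
  exact/hausdorff_accessible/norm_hausdorff.
have [[a Ca]|C0] := pselect (exists a, C a); last first.
  rewrite (_ : C = set0); first exact: finite_set0.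
  by rewrite -subset0 => a Ca; case: C0; exists a.
have [[b [Cb ab]]|C1] := pselect (exists b, C b /\ a <> b).
  apply: (@sub_finite_set _ _ [set a; b]); last exact: finite_set2.
  move=> c Cc; apply: contrapT => /not_orP[/= ca cb].
  by apply: (C3 _ _ _ Ca Cb Cc) => // /esym.
apply: (@sub_finite_set _ _ [set a]); last exact: finite_set1.
by move=> b Cb; apply: contrapT => /= ba; apply: C1; exists b; split=> // /esym.
Qed.

End Convergence.

Section MobiusSequence.
Context {R : realType} {n : nat}.
Context (G : nat -> 'rV[R]_n -> 'rV[R]_n) (z : nat -> 'rV[R]_n).
Context (mG : forall k, mobius (G k)) (hz : forall k, hball R n (z k)).
Context (Gz : forall k, G k (z k) = 0).
Implicit Types (x y w : 'rV[R]_n).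

Definition convergence_set : set 'rV[R]_n :=
  [set x | sphere R n x /\ exists w, G k x @[k --> \oo] --> w].

Let L := conical_limit_set (range z).

Lemma range_hball : range z `<=` hball R n.
Proof. by move=> _ [k _ <-]. Qed.

Lemma divergence_setE : divergence_set G = sphere R n `\` convergence_set.
Proof.
apply/seteqP; split=> x [sx nx]; split=> //.
  move=> [_ [w hw]]; apply: nx; exists w => //.
  by apply: cvg_sphere hw => k; exact: mobius_sphere.
by move=> [w sw hw]; apply: nx; split=> //; exists w.
Qed.

Lemma sphere_dist_le2 x k : sphere R n x -> enorm (z k - x) <= 2.
Proof.
move=> sx; apply: le_trans (enormD _ _) _; rewrite enormN sx.
by have : enorm (z k) < 1 := hz k; lra.
Qed.

(** As long as the points [z k] stay in a compact part of the ball, the maps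
    are uniformly Lipschitz on the sphere. *)
Lemma closed_convergence_set (d : R) N : 0 < d ->
  (forall k, (N <= k)%N -> d <= depth (z k)) -> closed convergence_set.
Proof.
move=> d0 zd x /closure_enorm clx.
have sx : sphere R n x.
  by apply: sphere_approx => e /clx[y [sy _] xy]; exists y.
split=> //; apply: cauchy_enorm => e e0.
have e8 : 0 < e * d / 8 by rewrite divr_gt0 ?mulr_gt0.
have e2 : 0 < e / 2 by rewrite divr_gt0.
have [y [sy [w /cvg_enormP/(_ _ e2)[N' hN']]] xy] := clx _ e8.
exists w, (maxn N N') => k; rewrite geq_max => /andP[Nk N'k].
apply: le_lt_trans (enorm_triangle (G k y) _ _) _.
suff : enorm (G k x - G k y) < e / 2 by have := hN' _ N'k; lra.
rewrite (mobius_chord (mG k) (hz k) (Gz k) sx sy).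
have zx := sphere_ball_neq sx (hz k); have zy := sphere_ball_neq sy (hz k).
rewrite ltr_pdivrMr ?mulr_gt0 //.
have := depth_le_dist sx (hz k); have := depth_le_dist sy (hz k).
have := zd _ Nk; move: xy zx zy (enorm_ge0 (x - y)).
move: (enorm (x - y)) (enorm (z k - x)) (enorm (z k - y)) (depth (z k)).
move=> p a b q hp a0 b0 p0 dq qb qa.
have q0 : 0 < q by exact: lt_le_trans dq.
have : q * q <= (2 * a) * (2 * b) by apply: ler_pM => //; lra.
have : q * p < q * (e * d / 8) by rewrite ltr_pM2l.
have : q * (e * d / 8) <= e / 8 * (q * q).
  rewrite (_ : q * (e * d / 8) = e / 8 * (q * d)); last by field.
  by rewrite ler_pM2l ?divr_gt0 // ler_pM2l.
have : e / 8 * (q * q) <= e / 8 * ((2 * a) * (2 * b)) -> 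
  e / 8 * (q * q) <= e / 2 * (a * b).
  by move=> /le_trans; apply; rewrite le_eqVlt; apply/orP; left; apply/eqP; field.
move=> h1 h2 h3 h4; apply: lt_le_trans h3 _; apply: le_trans h2 _.
by apply: h1; rewrite ler_pM2l ?divr_gt0.
Qed.

(** When [z k] is close to the sphere, [G k] almost collapses the complement of
    a small cap around [z k] to a point, so it brings two of any three given
    points together. Three distinct limits thus keep [z k] off the sphere. *)
Lemma three_limits y1 y2 y3 w1 w2 w3 :
  sphere R n y1 -> sphere R n y2 -> sphere R n y3 ->
  G k y1 @[k --> \oo] --> w1 -> G k y2 @[k --> \oo] --> w2 ->
  G k y3 @[k --> \oo] --> w3 ->
  w1 <> w2 -> w2 <> w3 -> w1 <> w3 ->
  exists d N, 0 < d /\ forall k, (N <= k)%N -> d <= depth (z k).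
Proof.
move=> s1 s2 s3 c1 c2 c3 n12 n23 n13.
have limne y y' w w' : G k y @[k --> \oo] --> w -> G k y' @[k --> \oo] --> w' ->
    w <> w' -> y != y'.
  move=> cy cy' ww'; apply/eqP => yy'; apply: ww'; rewrite yy' in cy.
  exact: (cvg_unique (@norm_hausdorff _ _) cy cy').
have y12 := limne _ _ _ _ c1 c2 n12; have y23 := limne _ _ _ _ c2 c3 n23.
have y13 := limne _ _ _ _ c1 c3 n13.
pose m (a b c : 'rV[R]_n) :=
  Num.min (enorm (a - b)) (Num.min (enorm (b - c)) (enorm (a - c))).
have h0 : 0 < m w1 w2 w3 / 2.
  by rewrite divr_gt0 // !lt_min !enorm_gt0 !subr_eq0; apply/and3P; split; apply/eqP.
have s0 : 0 < m y1 y2 y3 by rewrite !lt_min !enorm_gt0 !subr_eq0 y12 y23 y13.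
have h2 : 0 < m w1 w2 w3 / 2 / 2 by exact: divr_gt0.
have [N1 b1] := (cvg_enormP _ _).1 c1 _ h2.
have [N2 b2] := (cvg_enormP _ _).1 c2 _ h2.
have [N3 b3] := (cvg_enormP _ _).1 c3 _ h2.
exists (m w1 w2 w3 / 2 * m y1 y2 y3 / 4), (maxn N1 (maxn N2 N3)).
split; first by apply: divr_gt0; [exact: mulr_gt0|].
move=> k; rewrite !geq_max => /and3P[k1 k2 k3].
have {}b1 := b1 _ k1; have {}b2 := b2 _ k2; have {}b3 := b3 _ k3.
have hw : [/\ m w1 w2 w3 <= enorm (w1 - w2), m w1 w2 w3 <= enorm (w2 - w3) &
    m w1 w2 w3 <= enorm (w1 - w3)].
  by split; rewrite /m !ge_min lexx ?orbT.
have hy : [/\ m y1 y2 y3 <= enorm (y1 - y2), m y1 y2 y3 <= enorm (y2 - y3) &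
    m y1 y2 y3 <= enorm (y1 - y3)].
  by split; rewrite /m !ge_min lexx ?orbT.
move: (m w1 w2 w3) (m y1 y2 y3) h0 s0 h2 b1 b2 b3 hw hy => h s h0 s0 _ b1 b2 b3.
move=> [w12 w23 w13] [d12 d23 d13].
have sep y y' w w' : sphere R n y -> sphere R n y' ->
    enorm (G k y - w) < h / 2 / 2 -> enorm (G k y' - w') < h / 2 / 2 ->
    h <= enorm (w - w') -> h / 2 <= cone_ratio (z k) y + cone_ratio (z k) y'.
  move=> sy sy' cy cy' ww'.
  have := mobius_chord_le (mG k) (hz k) (Gz k) sy sy'.
  have := enorm_triangle (G k y) w w'; have := enorm_triangle (G k y') (G k y) w'.
  by rewrite (enorm_subC w (G k y)); lra.
have := sep _ _ _ _ s1 s2 b1 b2 w12; have := sep _ _ _ _ s2 s3 b2 b3 w23.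
have := sep _ _ _ _ s1 s3 b1 b3 w13.
have near y y' : sphere R n y -> sphere R n y' -> s <= enorm (y - y') ->
    h / 4 <= cone_ratio (z k) y -> h / 4 <= cone_ratio (z k) y' ->
    h / 2 * s / 4 <= depth (z k).
  move=> sy sy' yy'; rewrite /cone_ratio !ler_pdivlMr ?sphere_ball_neq // => a a'.
  have := enorm_triangle (z k) y y'; rewrite (enorm_subC y (z k)).
  move=> tri; have : h * s <= h * (enorm (z k - y) + enorm (z k - y')).
    by rewrite ler_wpM2l //; lra.
  by rewrite mulrDr; lra.
have := near _ _ s1 s2 d12; have := near _ _ s2 s3 d23; have := near _ _ s1 s3 d13.
move: (cone_ratio _ y1) (cone_ratio _ y2) (cone_ratio _ y3) => q1 q2 q3.
move=> i13 i23 i12 j13 j23 j12.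
have [q1h|q1h] := leP (h / 4) q1; last by apply: i23; lra.
by have [q2h|q2h] := leP (h / 4) q2; [exact: i12 | apply: i13 => //; lra].
Qed.

Definition depth_to0 := forall e, 0 < e ->
  exists N, forall k, (N <= k)%N -> depth (z k) < e.

(** While [z k] is in a compact part of the ball, [G k] shrinks chords of the
    sphere by a bounded factor only. *)
Lemma not_depth_to0_limits x y w w' : ~ depth_to0 ->
  sphere R n x -> sphere R n y -> x <> y ->
  G k x @[k --> \oo] --> w -> G k y @[k --> \oo] --> w' -> w <> w'.
Proof.
move=> nd sx sy xy cx cy.
have [d d0 hd] : exists2 d, 0 < d & forall N, exists2 k, (N <= k)%N & d <= depth (z k).
  apply: contrapT => h; apply: nd => e e0; apply: contrapT => h'; apply: h.
  exists e => // N; apply: contrapT => h; apply: h'; exists N => k Nk.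
  by rewrite ltNge; apply/negP => ek; apply: h; exists k.
have xy0 : 0 < enorm (x - y) by rewrite enorm_gt0 subr_eq0; apply/eqP.
apply: (cvg_apart (c := d * enorm (x - y) / 4) _ cx cy) => [|N].
  by rewrite divr_gt0 ?mulr_gt0.
have [k Nk dk] := hd N; exists k => //.
rewrite (mobius_chord (mG k) (hz k) (Gz k) sx sy).
have zx := sphere_ball_neq sx (hz k); have zy := sphere_ball_neq sy (hz k).
rewrite ler_pM ?mulr_ge0 ?invr_ge0 ?(ltW d0) ?enorm_ge0 ?ler_wpM2r ?enorm_ge0 //.
rewrite lef_pV2 ?posrE ?mulr_gt0 // (_ : 4 = 2 * 2) -?natrM //.
by rewrite natrM ler_pM ?enorm_ge0 // sphere_dist_le2.
Qed.

Lemma conical_infinitely_often x : conical_point (range z) x ->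
  exists2 M, 0 < M & forall N, exists2 k, (N <= k)%N & 
    enorm (z k - x) <= M * depth (z k).
Proof.
move=> [M hM]; exists (`|M| + 1) => [|N]; first by have := normr_ge0 M; lra.
have [e e0 he] : exists2 e, 0 < e & forall k, (k < N)%N -> e <= depth (z k).
  elim: N => [|N [e e0 he]]; first by exists 1.
  exists (Num.min e (depth (z N))); first by rewrite lt_min e0 hball_depth.
  move=> k; rewrite ltnS leq_eqVlt => /predU1P[->|/he ek].
    by rewrite ge_min lexx orbT.
  by rewrite ge_min ek.
have [_ [k _ <-] [h1 h2]] := hM _ e0; exists k.
  by rewrite leqNgt; apply/negP => /he; rewrite leNgt h2.
apply: le_trans h1 _; rewrite ler_wpM2r ?(ltW (hball_depth _)) //.
by have := ler_norm M; lra.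
Qed.

(** Along the points that approach [x] conically, [x] is kept apart from every
    other point of the sphere. *)
Lemma conical_limits x y w w' : conical_point (range z) x ->
  sphere R n x -> sphere R n y -> x <> y ->
  G k x @[k --> \oo] --> w -> G k y @[k --> \oo] --> w' -> w <> w'.
Proof.
move=> /conical_infinitely_often[M M0 hM] sx sy xy cx cy.
have xy0 : 0 < enorm (x - y) by rewrite enorm_gt0 subr_eq0; apply/eqP.
apply: (cvg_apart (c := M^-1 * (enorm (x - y) / 2)) _ cx cy) => [|N].
  by rewrite mulr_gt0 ?divr_gt0 ?invr_gt0.
have [k Nk hk] := hM N; exists k => //.
rewrite (mobius_chord_ratio (mG k) (hz k) (Gz k) sx sy).
have zx := sphere_ball_neq sx (hz k); have zy := sphere_ball_neq sy (hz k).
apply: ler_pM; rewrite ?invr_ge0 ?divr_ge0 ?enorm_ge0 ?(ltW M0) //.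
  by rewrite /cone_ratio ler_pdivlMr // mulrC ler_pdivrMr // mulrC.
by rewrite ler_wpM2l ?enorm_ge0 // lef_pV2 ?posrE // sphere_dist_le2.
Qed.

Lemma nonconical_ratio x : depth_to0 -> sphere R n x ->
  ~ conical_point (range z) x ->
  forall e, 0 < e -> exists N, forall k, (N <= k)%N -> cone_ratio (z k) x < e.
Proof.
move=> d0 sx nc e e0; apply: contrapT => h; apply: nc; exists e^-1 => r r0.
have [N hN] := d0 _ r0; apply: contrapT => h'; apply: h; exists N => k Nk.
rewrite ltNge; apply/negP => ek; apply: h'; exists (z k); first by exists k.
split; last exact: hN.
move: ek; rewrite /cone_ratio ler_pdivlMr ?sphere_ball_neq // => ek.
by rewrite mulrC ler_pdivlMr // mulrC.
Qed.

(** Away from the conical limit set all points have asymptotic images. *)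
Lemma nonconical_limit x y w : depth_to0 -> sphere R n x -> sphere R n y ->
  ~ conical_point (range z) x -> ~ conical_point (range z) y ->
  G k y @[k --> \oo] --> w -> G k x @[k --> \oo] --> w.
Proof.
move=> d0 sx sy nx ny /cvg_enormP cy; apply/cvg_enormP => e e0.
have e3 : 0 < e / 3 by rewrite divr_gt0.
have [N1 h1] := cy _ e3; have [N2 h2] := nonconical_ratio d0 sx nx e3.
have [N3 h3] := nonconical_ratio d0 sy ny e3.
exists (maxn N1 (maxn N2 N3)) => k; rewrite !geq_max => /and3P[/h1 k1 /h2 k2 /h3 k3].
have := enorm_triangle (G k y) (G k x) w.
by have := mobius_chord_le (mG k) (hz k) (Gz k) sx sy; lra.
Qed.

(** Three convergent points either have distinct limits, and then
    [three_limits] makes [G] equicontinuous, or the [z k] tend to the sphere. In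
    the second case convergence at one point outside [L] forces it at all others,
    and [conical_limits] leaves room for at most two points of [L]. *)
Lemma divergence_dichotomy : closed convergence_set \/
  closed (convergence_set `&` L) /\ sphere R n `\` L `<=` convergence_set.
Proof.
have LP x : L x <-> sphere R n x /\ conical_point (range z) x.
  exact: conical_limit_setP range_hball.
have [[d [N [d0 hd]]]|shallow] := pselect (exists d N, 0 < d /\
    forall k, (N <= k)%N -> d <= depth (z k)).
  by left; exact: closed_convergence_set hd.
have [no3|three] := pselect (no_three convergence_set).
  by left; exact: no_three_closed.
have [y1 [y2 [y3 [C1 C2 C3 [n12 n23 n13]]]]] : exists y1 y2 y3,
    [/\ convergence_set y1, convergence_set y2, convergence_set y3 &
     [/\ y1 <> y2, y2 <> y3 & y1 <> y3]].
  by apply: contrapT => h; apply: three => y1 y2 y3 *; apply: h; exists y1, y2, y3.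
have d0 : depth_to0.
  apply: contrapT => nd; apply: shallow.
  move: C1 C2 C3 => [s1 [w1 c1]] [s2 [w2 c2]] [s3 [w3 c3]].
  by apply: (three_limits s1 s2 s3 c1 c2 c3);
    [apply: not_depth_to0_limits c1 c2 | apply: not_depth_to0_limits c2 c3 |
     apply: not_depth_to0_limits c1 c3].
have CL3 : no_three (convergence_set `&` L).
  move=> x1 x2 x3 [[s1 [w1 c1]] /LP[_ l1]] [[s2 [w2 c2]] /LP[_ l2]] [[s3 [w3 c3]] _].
  move=> m12 m23 m13; apply: shallow; apply: (three_limits s1 s2 s3 c1 c2 c3).
  - exact: conical_limits c1 c2.
  - exact: conical_limits c2 c3.
  - exact: conical_limits c1 c3.
right; split; first exact: no_three_closed.
have [y [Cy nLy]] : exists y, convergence_set y /\ ~ L y.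
  apply: contrapT => h; apply: (CL3 y1 y2 y3) => //; split=> //;
  by apply: contrapT => nL; apply: h; eexists; split; last exact: nL.
case: Cy => sy [w cy] x [sx nLx]; split=> //; exists w.
apply: nonconical_limit cy => // c; first by apply: nLx; apply/LP.
by apply: nLy; apply/LP.
Qed.

Lemma divergence_conical : exists E,
  E `<=` hball R n /\ divergence_set G = conical_limit_set E.
Proof.
rewrite divergence_setE; case: divergence_dichotomy => [cl|[cl sub]].
  have [E EB EE] := closed_conical (@subset_refl _ (hball R n)) cl.
  by exists E; rewrite EE conical_limit_hball.
have [E EB EE] := closed_conical range_hball cl.
exists E; rewrite EE -/L; split=> //; apply/seteqP; split=> x [h nC].
  have Lx : L x by apply: contrapT => nL; apply: nC; apply: sub.
  by split=> // -[].
have [sx _] := iffLR (conical_limit_setP x range_hball) h.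
by split=> // Cx; apply: nC.
Qed.

End MobiusSequence.

(** * Orientation *)

Section Orientation.
Context {R : realType}.

(** Both sides are the determinant of the block matrix with identity diagonal
    blocks and off-diagonal blocks [c] and [w]. *)
Lemma det_rank_one n (c : 'cV[R]_n) (w : 'rV[R]_n) :
  \det (1%:M - c *m w) = 1 - (w *m c) 0 0.
Proof.
have e1 : block_mx 1%:M c w (1%:M : 'M[R]_1) =
    block_mx 1%:M 0 w 1%:M *m block_mx 1%:M c 0 (1%:M - w *m c).
  by rewrite mulmx_block !mulmx0 !mul0mx !mul1mx !mulmx1 !addr0 subrKC.
have e2 : block_mx 1%:M c w (1%:M : 'M[R]_1) =
    block_mx (1%:M - c *m w) c 0 1%:M *m block_mx 1%:M 0 w 1%:M.
  by rewrite mulmx_block !mulmx0 !mul0mx !mul1mx !mulmx1 !add0r subrK.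
have := congr1 determinant e1; rewrite e2 !det_mulmx !det_ublock !det_lblock.
by rewrite !det1 !mul1r !mulr1 det_mx11 !mxE => ->.
Qed.

Definition reflection_mx n (u : 'rV[R]_n) : 'M[R]_n := 1%:M - (2 *: u^T) *m u.

Lemma reflection_mxE n (u x : 'rV[R]_n) :
  x *m reflection_mx u = hyperplane_reflection u x.
Proof.
rewrite mulmxBr mulmx1 mulmxA -scalemxAr /hyperplane_reflection.
rewrite (_ : x *m u^T = (dotp x u)%:M).
  by rewrite scale_scalar_mx mul_scalar_mx.
apply/rowP => i; rewrite ord1 !mxE eqxx mulr1n.
by apply: eq_bigr => j _; rewrite !mxE.
Qed.

Lemma det_reflection_mx n (u : 'rV[R]_n) : enorm u = 1 -> \det (reflection_mx u) = -1.
Proof.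
move=> hu; rewrite det_rank_one -scalemxAr !mxE.
rewrite (_ : \sum_j _ = dotp u u); last by apply: eq_bigr => j _; rewrite mxE.
by rewrite -sqr_enorm hu; ring.
Qed.

Lemma is_diff_sum (V W : normedModType R) m (f df : 'I_m -> V -> W) (p : V) :
  (forall i, is_diff p (f i) (df i)) ->
  is_diff p (fun y => \sum_i f i y) (fun h => \sum_i df i h).
Proof.
move=> fd.
have -> : (fun y => \sum_i f i y) = \sum_i f i by rewrite funeqE => y; rewrite fct_sumE.
have -> : (fun y => \sum_i df i y) = \sum_i df i by rewrite funeqE => y; rewrite fct_sumE.
elim/big_ind2: _ => // *; [exact: is_diff_cst | exact: is_diffD].
Qed.

Section Differentials.
Context {n : nat}.
Implicit Types (x y a u : 'rV[R]_n).

Lemma is_diff_coord x i : is_diff x (fun y => y 0 i) (fun h => h 0 i).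
Proof.
apply: DiffDef; first exact: differentiable_coord.
have lin : linear (fun y : 'rV[R]_n => y 0 i) by move=> k y z; rewrite !mxE.
pose linM := GRing.isLinear.Build _ _ _ _ _ lin.
pose linL : {linear _ -> _} := HB.pack (fun y : 'rV[R]_n => y 0 i) linM.
have := @diff_lin _ _ _ linL x; apply; exact: coord_continuous.
Qed.

Lemma is_diff_coord_sub a x i :
  is_diff x (fun y => y 0 i - a 0 i) (fun h => h 0 i).
Proof.
have -> : (fun y : 'rV[R]_n => y 0 i - a 0 i) =
    (fun y : 'rV[R]_n => y 0 i) - cst (a 0 i) by rewrite funeqE.
apply: is_diff_eq (is_diffB (is_diff_coord x i) (is_diff_cst (a 0 i) x)) _.
by rewrite subr0.
Qed.

Lemma is_diff_row (f df : 'rV[R]_n -> 'rV[R]_n) x :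
  (forall j, is_diff x (fun y => f y 0 j) (fun h => df h 0 j)) -> is_diff x f df.
Proof.
move=> fd.
have rowE (g : 'rV[R]_n -> 'rV[R]_n) :
    g = (fun y => \sum_j (g y 0 j) *: delta_mx 0 j).
  by rewrite funeqE => y; rewrite [LHS]row_sum_delta.
rewrite (rowE f) (rowE df); apply: is_diff_sum => j.
apply: DiffDef; first by apply: differentiableZl; exact: ex_diff.
by rewrite diffZl ?diff_val //; exact: ex_diff.
Qed.

Lemma is_diff_mulmx (B : 'M[R]_n) x : is_diff x (mulmxr B) (mulmxr B).
Proof.
apply: is_diff_row => j.
have -> : (fun y : 'rV[R]_n => mulmxr B y 0 j) =
    (fun y => \sum_i (B i j *: (fun p : 'rV[R]_n => p 0 i : R)) y).
  by rewrite funeqE => y; rewrite /= mxE; apply: eq_bigr => i _; rewrite mulrC.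
by apply: is_diff_sum => i; apply: is_diffZ; exact: is_diff_coord.
Qed.

Lemma is_diff_sqr_dist a x :
  is_diff x (fun y => enorm (y - a) ^+ 2) (fun h => 2 * dotp (x - a) h).
Proof.
have cd i := is_diff_coord_sub a x i.
have := is_diff_sum (fun i => is_diffM (cd i) (cd i)).
have -> : (fun y => enorm (y - a) ^+ 2) =
    (fun y => \sum_i ((fun p : 'rV[R]_n => p 0 i - a 0 i) *
                      (fun p : 'rV[R]_n => p 0 i - a 0 i)) y).
  by rewrite funeqE => y; rewrite sqr_enorm; apply: eq_bigr => i _; rewrite !mxE.
move=> hd; apply: is_diff_eq hd _; rewrite funeqE => h; rewrite mulr_sumr.
apply: eq_bigr => i _; rewrite !mxE.
rewrite -[LHS]/((x 0 i - a 0 i) * h 0 i + (x 0 i - a 0 i) * h 0 i); ring.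
Qed.

Lemma is_diff_inversion a r x : x != a ->
  is_diff x (inversion a r) (fun h => (r ^+ 2 / enorm (x - a) ^+ 2) *:
     hyperplane_reflection ((enorm (x - a))^-1 *: (x - a)) h).
Proof.
rewrite -(subr_eq0 _ a) -enorm_eq0 => xa.
have N0 : enorm (x - a) ^+ 2 != 0 by rewrite expf_neq0.
have dN := is_diff_sqr_dist a x.
have dV : is_diff x (fun y => (enorm (y - a) ^+ 2)^-1)
    (fun h => - (enorm (x - a) ^+ 2) ^- 2 * (2 * dotp (x - a) h)).
  apply: DiffDef; first by apply: differentiableV => //; exact: ex_diff.
  by rewrite diffV ?diff_val //; exact: ex_diff.
apply: is_diff_row => j.
have cd := is_diff_coord_sub a x j.
have := is_diffD (is_diff_cst (a 0 j : R) x)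
  (is_diffZ (r ^+ 2) (is_diffM dV cd)).
have -> : (fun y => inversion a r y 0 j) = cst (a 0 j) + r ^+ 2 *:
    ((fun y => (enorm (y - a) ^+ 2)^-1) * (fun y => y 0 j - a 0 j)).
  by rewrite funeqE => y; rewrite /inversion !mxE -mulrA.
move=> hd; apply: is_diff_eq hd _; rewrite funeqE => h.
rewrite /hyperplane_reflection !dotpZr !mxE (dotpC h).
rewrite -[LHS]/(0 + r ^+ 2 * ((enorm (x - a) ^+ 2)^-1 * h 0 j +
  (x 0 j - a 0 j) * (- (enorm (x - a) ^+ 2) ^- 2 * (2 * dotp (x - a) h)))).
by move: (enorm (x - a)) (dotp _ _) xa => p d p0; field.
Qed.

Lemma lin1_mx_mulmx (f : 'rV[R]_n -> 'rV[R]_n) (B : 'M[R]_n) :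
  (forall h, f h = h *m B) -> lin1_mx f = B.
Proof. by move=> fB; apply/matrixP => i j; rewrite mxE fB -rowE mxE. Qed.

(** An inversion has differential a multiple of a reflection, so composing it
    with another reflection gives a differential of positive determinant. *)
Lemma orientation_inversion_reflection a r u : 0 < r ->
  enorm a ^+ 2 = 1 + r ^+ 2 -> enorm u = 1 ->
  orientation_preserving (hyperplane_reflection u \o inversion a r).
Proof.
move=> r0 ha hu x /ltW x1; have xa := center_out r0 ha x1.
have d1 := is_diff_inversion r xa.
have d2 : is_diff (inversion a r x) (hyperplane_reflection u) (hyperplane_reflection u).
  have -> : hyperplane_reflection u = mulmxr (reflection_mx u).
    by rewrite funeqE => y; rewrite /= reflection_mxE.
  exact: is_diff_mulmx.
rewrite /jacobian (@diff_val _ _ _ _ _ _ _ (is_diff_comp d1 d2)).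
have X0 : 0 < enorm (x - a) by rewrite enorm_gt0 subr_eq0.
set k := r ^+ 2 / _; set v := _ *: (x - a).
have k0 : 0 < k by rewrite divr_gt0 ?exprn_gt0.
have hv : enorm v = 1 by rewrite enormZ ger0_norm ?invr_ge0 ?ltW // mulVf ?gt_eqF.
rewrite (@lin1_mx_mulmx _ (k *: (reflection_mx v *m reflection_mx u))); last first.
  by move=> h; rewrite /= -!reflection_mxE -scalemxAl -scalemxAr mulmxA.
rewrite detZ det_mulmx !det_reflection_mx // mulrNN !mulr1.
exact: exprn_gt0.
Qed.

End Differentials.
End Orientation.

(** * From conical limits to divergence *)

Section Centering.
Context {R : realType} {n : nat}.
Implicit Types (x y z a u : 'rV[R]_n).

Lemma reflection_between x y u : enorm x = 1 -> enorm y = 1 -> enorm u = 1 ->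
  dotp y u = 0 -> exists2 v, enorm v = 1 & hyperplane_reflection v x = y.
Proof.
move=> hx hy hu yu; have [->|xy] := eqVneq x y.
  by exists u => //; rewrite /hyperplane_reflection yu mulr0 scale0r subr0.
have d0 : 0 < enorm (x - y) by rewrite enorm_gt0 subr_eq0.
exists ((enorm (x - y))^-1 *: (x - y)).
  by rewrite enormZ ger0_norm ?invr_ge0 ?ltW // mulVf ?gt_eqF.
have hd : 2 * dotp x (x - y) = enorm (x - y) ^+ 2.
  by rewrite sqr_enorm_sub hx hy !dotpE -!sqr_enorm hx; ring.
rewrite /hyperplane_reflection dotpZr scalerA mulrCA hd.
rewrite (_ : _ * _ = 1); last by field; rewrite gt_eqF.
by rewrite scale1r opprB addrC subrK.
Qed.

(** Inversion in the sphere centred at [z / |z| ^ 2], followed by a reflection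
    that restores the orientation and aims the result. *)
Lemma centering z y u : hball R n z -> z != 0 -> enorm y = 1 -> enorm u = 1 ->
  dotp y u = 0 -> exists G, [/\ mobius G, orientation_preserving G, G z = 0 &
    G (- ((enorm z)^-1 *: z)) = y].
Proof.
move=> hz z0 hy hu yu; have nz : 0 < enorm z by rewrite enorm_gt0.
have nz1 : enorm z < 1 by exact: hz.
have [c cE] : exists c, c = (enorm z)^-1 *: z by eexists.
have hc : enorm c = 1 by rewrite cE enormZ ger0_norm ?invr_ge0 ?ltW // mulVf ?gt_eqF.
have zE : z = enorm z *: c by rewrite cE scalerA divff ?gt_eqF ?scale1r.
have [v hv vc] := reflection_between hc hy hu yu.
have r0 : 0 < (enorm z ^+ 2)^-1 - 1.
  by rewrite subr_gt0 invf_gt1 ?exprn_gt0 // expr_lt1 ?ltW.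
pose r := Num.sqrt ((enorm z ^+ 2)^-1 - 1); pose a := (enorm z)^-1 *: c.
have rp : 0 < r by rewrite sqrtr_gt0.
have r2 : r ^+ 2 = (enorm z ^+ 2)^-1 - 1 by rewrite sqr_sqrtr // ltW.
have ha : enorm a ^+ 2 = 1 + r ^+ 2.
  by rewrite r2 enormZ hc mulr1 real_normK ?num_real // exprVn; ring.
(* on the axis through [a], the inversion is explicit *)
have axis t : t * enorm z != 1 ->
    inversion a r (t *: c) = ((t - enorm z) / (t * enorm z - 1)) *: c.
  move=> t1; rewrite /inversion /a -scalerBl enormZ hc mulr1 scalerA -scalerDl.
  congr (_ *: _); rewrite real_normK ?num_real // r2.
  move: (enorm z) nz t1 => s s0; rewrite -subr_eq0 => t1; field.
  by rewrite t1 gt_eqF.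
exists (hyperplane_reflection v \o inversion a r); split.
- apply: (MobiusComp (HyperplaneReflection hv)).
  exact: (MobiusComp (SphereInversion rp ha) (@MobiusId R n)).
- exact: orientation_inversion_reflection.
- have sq : enorm z * enorm z != 1 by rewrite lt_eqF // mulr_ilt1 // ltW.
  rewrite /= {1}zE axis // subrr mul0r scale0r.
  by rewrite -reflection_mxE mul0mx.
- rewrite -cE -scaleN1r /= axis; last first.
    by rewrite mulN1r lt_eqF // (lt_trans _ ltr01) // oppr_lt0.
  rewrite (_ : _ / _ = 1) ?scale1r //; field; lra.
Qed.

End Centering.

Section Horosphere.
Context {R : realType} {n : nat}.
Implicit Types (x y z : 'rV[R]_n).

(** Points that approach the sphere along a horosphere are not conical
    anywhere: they converge to its base point, tangentially. *)
Lemma horosphere_not_conical E y x : E `<=` hball R n ->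
  (forall z, E z -> enorm (z - y) ^+ 2 = depth z) -> ~ conical_point E x.
Proof.
move=> EB hE cx.
have [xy|xy] := eqVneq x y.
  have : conical_point (E `&` off_horoballs [set y]) x.
    by apply: conical_pointS cx => z Ez; split=> // _ ->; rewrite hE.
  have cl : closed [set y].
    exact/accessible_closed_set1/hausdorff_accessible/norm_hausdorff.
  by case/(iffLR (conical_point_off_horoballs x EB cl)).
have d0 : 0 < enorm (x - y) by rewrite enorm_gt0 subr_eq0.
move: cx => [M hM]; have M0 := sqr_ge0 M.
have [|z Ez [h1]] := hM (enorm (x - y) ^+ 2 / (2 * M ^+ 2 + 2)).
  by rewrite divr_gt0 ?exprn_gt0 //; lra.
rewrite ltr_pdivlMr; last lra.
have dz := hball_depth (EB _ Ez); have := depth_le1 z; have := hE _ Ez.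
have : enorm (z - x) ^+ 2 <= (M * depth z) ^+ 2.
  by rewrite lerXn2r ?nnegrE ?enorm_ge0 // (le_trans (enorm_ge0 _) h1).
have : enorm (x - y) ^+ 2 <= 2 * enorm (z - x) ^+ 2 + 2 * enorm (z - y) ^+ 2.
  have := enorm_triangle z x y; rewrite (enorm_subC x z).
  move: (enorm_ge0 (x - y)) (sqr_ge0 (enorm (z - x) - enorm (z - y))).
  move: (enorm _) (enorm _) (enorm _) => p q r p0 qr pqr; nra.
rewrite exprMn; move: (enorm _ ^+ 2) (enorm _ ^+ 2) (enorm _ ^+ 2) (M ^+ 2) M0.
move=> p q r K K0 h2 h3 h4 h5 h6.
have : K * depth z ^+ 2 <= K * depth z by rewrite ler_wpM2l //; nra.
lra.
Qed.

Lemma conical_pointU E F x :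
  conical_point (E `|` F) x -> conical_point E x \/ conical_point F x.
Proof.
move=> [M hM]; apply: contrapT => /not_orP[nE nF].
have [e1 e10 h1] : exists2 e, 0 < e & forall z, E z ->
    enorm (z - x) <= M * depth z -> e <= depth z.
  apply: contrapT => h; apply: nE; exists M => e e0; apply: contrapT => h'.
  apply: h; exists e => // z Ez hz; rewrite leNgt; apply/negP => ze.
  by apply: h'; exists z.
have [e2 e20 h2] : exists2 e, 0 < e & forall z, F z ->
    enorm (z - x) <= M * depth z -> e <= depth z.
  apply: contrapT => h; apply: nF; exists M => e e0; apply: contrapT => h'.
  apply: h; exists e => // z Ez hz; rewrite leNgt; apply/negP => ze.
  by apply: h'; exists z.
have [|z EFz [hz]] := hM (Num.min e1 e2); first by rewrite lt_min e10.
rewrite lt_min => /andP[z1 z2]; case: EFz => [/h1|/h2] /(_ hz); lra.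
Qed.

End Horosphere.

Section Discretisation.
Context {R : realType} {n : nat}.
Implicit Types (x p c : 'rV[R]_n) (E : set 'rV[R]_n).

Lemma ball_net (e : R) : 0 < e ->
  exists s : seq 'rV[R]_n, forall p, hball R n p ->
    exists2 c, c \in s & enorm (p - c) < e.
Proof.
move=> e0; have n0 : 0 < n.+1%:R :> R by rewrite ltr0n.
pose K := [set p : 'rV[R]_n | `|p| <= 1].
have cK : compact K.
  apply: bounded_closed_compact.
    by exists 1; split=> // t t1 p /= /le_trans; apply; exact: ltW.
  have -> : K = closed_ball_ (fun p => `|p|) 0 1.
    by rewrite /K /closed_ball_; under [RHS]eq_set do rewrite sub0r normrN.
  exact: closed_closed_ball_.
rewrite compact_cover in cK.
have [c _|p Kp|D _ hD] := cK _ setT (fun c => ball c (e / n.+1%:R)).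
- exact: ball_open.
- by exists p => //; apply: ballxx; rewrite divr_gt0.
exists (finmap.enum_fset D) => p hp.
have [|c /= cD] := hD p.
  exact: le_trans (mx_norm_le_enorm _) (ltW hp).
rewrite -ball_normE /= ltr_pdivlMr // => h; exists c => //.
rewrite enorm_subC; apply: le_lt_trans (enorm_le_mx_norm _) _.
apply: le_lt_trans h.
by rewrite mulrC ler_wpM2l // ler_nat.
Qed.

(** Replacing each point of [E] by a nearby representative, one for each
    member of a finite net adapted to its depth, loses no conical limit point,
    and leaves finitely many points above every positive depth. The sequence
    [w] fills the indices that no representative uses. *)
Lemma discretisation E (w : nat -> 'rV[R]_n) : E `<=` hball R n ->
  depth_to0 w ->
  exists z, [/\ depth_to0 z,
    forall k, (exists j, z k = w j) \/ E (z k) /\ depth (z k) <= 1 / 2 &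
    forall x, conical_point E x -> conical_point (range z) x].
Proof.
move=> EB w0.
have /choice[s hs] (k : nat) : exists s : seq 'rV[R]_n, forall p, hball R n p ->
    exists2 c, c \in s & enorm (p - c) < k.+3%:R^-1.
  by apply: ball_net; rewrite invr_gt0 ltr0n.
(* [p] has depth of order [1 / k] and lies near the [i]-th point of the net *)
pose P k i p := [/\ E p, k.+3%:R^-1 <= depth p, depth p <= k.+2%:R^-1,
  (i < size (s k))%N & enorm (p - nth 0 (s k) i) < k.+3%:R^-1].
have /choice[z hz] (m : nat) : exists p,
    (exists k i, m = pickle (k, i) /\ P k i p) \/
    (~ (exists k i q, m = pickle (k, i) /\ P k i q) /\ p = w m).
  have [[k [i [q [mE Pq]]]]|h] := pselect
      (exists k i q, m = pickle (k, i) /\ P k i q).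
    by exists q; left; exists k, i.
  by exists (w m); right.
have inv_le (a b : nat) : (a <= b)%N -> b.+1%:R^-1 <= a.+1%:R^-1 :> R.
  by move=> ab; rewrite lef_pV2 ?posrE ?ltr0n // ler_nat ltnS.
exists z; split.
- move=> e e0.
  have [K hK] : exists K : nat, K.+1%:R^-1 < e.
    exists (Num.truncn e^-1).+1; rewrite invf_plt ?posrE ?ltr0n //.
    by apply: lt_trans (truncnS_gt _) _; rewrite ltr_nat.
  have [N hN] := w0 _ e0.
  pose B := \max_(k < K) \max_(i < size (s k)) pickle (k : nat, i : nat).
  exists (maxn N B.+1) => m; rewrite geq_max => /andP[Nm Bm].
  have [[k [i [mE [_ _ d2 si _]]]]|[_ ->]] := hz m; last exact: hN.
  have [kK|Kk] := ltnP k K; last first.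
    by apply: le_lt_trans d2 _; apply: le_lt_trans hK; apply: inv_le; rewrite leqW.
  suff : (m <= B)%N by rewrite leqNgt Bm.
  rewrite mE; apply: leq_trans (leq_bigmax (Ordinal kK)).
  exact: (leq_bigmax (F := fun i : 'I_(size (s k)) => pickle (k, i : nat)) (Ordinal si)).
- move=> m; have [[k [i [_ [Ez _ d2 _ _]]]]|[_ ->]] := hz m; last by left; exists m.
  right; split=> //; apply: le_trans d2 _; rewrite div1r.
  exact: (inv_le 1%N).
move=> x [M hM]; exists (2 + 2 * `|M|) => e e0.
have [|p Ep [h1]] := hM (Num.min (e / 2) (1 / 2)).
  by rewrite lt_min !divr_gt0.
rewrite lt_min => /andP[h2 h3].
have dp := hball_depth (EB _ Ep).
pose T := Num.truncn (depth p)^-1.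
have /andP[T1 T2] : T%:R <= (depth p)^-1 < T.+1%:R.
  by apply: truncn_itv; rewrite invr_ge0 ltW.
have T3 : (2 <= T)%N.
  rewrite -ltnS -(ltr_nat R); apply: lt_trans T2.
  by rewrite invf_pgt ?posrE // -[2^-1]div1r.
have [k TE] : exists k, T = k.+2 by exists T.-2; lia.
rewrite TE in T1 T2.
have l1 : k.+3%:R^-1 <= depth p by rewrite invf_ple ?posrE ?ltr0n // ltW.
have l2 : depth p <= k.+2%:R^-1 by rewrite invf_pge ?posrE ?ltr0n.
have [c cs pc] := hs k _ (EB _ Ep).
have Pp : P k (index c (s k)) p by split; rewrite ?index_mem ?nth_index.
have [[k' [i' [/(pcan_inj pickleK_inv)[<- <-] [Eq q1 q2 _ q3]]]]|[]] :=
  hz (pickle (k, index c (s k))); last first.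
  by move=> nP; case: nP; exists k, (index c (s k)), p.
set q := z _ in Eq q1 q2 q3; exists q; first by exists (pickle (k, index c (s k))).
rewrite nth_index // in q3.
have k3 : 0 < k.+3%:R :> R by rewrite ltr0n.
have k23 : k.+2%:R^-1 <= 2 * k.+3%:R^-1 :> R.
  rewrite -[X in X <= _]mul1r ler_pdivrMr ?ltr0n // mulrAC ler_pdivlMr // mul1r.
  have : 1 <= k.+2%:R :> R by rewrite ler1n.
  by rewrite -[k.+3]addn1 natrD; lra.
have M0 := normr_ge0 M.
have dpq : depth p <= 2 * depth q.
  by apply: le_trans l2 _; apply: le_trans k23 _; rewrite ler_pM2l.
have dqp : depth q <= 2 * depth p.
  by apply: le_trans q2 _; apply: le_trans k23 _; rewrite ler_pM2l.
have {}pc := lt_le_trans pc q1; have {}q3 := lt_le_trans q3 q1.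
clear q1 q2 k23 l1 l2 k3; split; last lra.
have := enorm_triangle p q x; have := enorm_triangle c q p.
rewrite (enorm_subC c p).
have : M * depth p <= `|M| * (2 * depth q).
  by apply: le_trans (ler_norm _) _; rewrite normrM (gtr0_norm dp) ler_wpM2l.
lra.
Qed.

End Discretisation.

Section Construction.
Context {R : realType} {m : nat}.
Notation V := 'rV[R]_m.+2.

Let e1 : V := delta_mx 0 ord0.
Let e2 : V := delta_mx 0 ord_max.

Lemma dotp_delta (i j : 'I_m.+2) :
  dotp (delta_mx 0 i : V) (delta_mx 0 j) = (i == j)%:R.
Proof.
rewrite /dotp (bigD1 i) //= big1 => [|k ki]; last by rewrite !mxE (negbTE ki) mul0r.
by rewrite !mxE !eqxx mul1r addr0.
Qed.

Lemma enorm_delta (i : 'I_m.+2) : enorm (delta_mx 0 i : V) = 1.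
Proof. by rewrite /enorm dotp_delta eqxx sqrtr1. Qed.

(** A parabolic orbit on the horosphere at [e1] through the origin. *)
Definition horocycle (k : nat) : V :=
  (1 + k.+1%:R ^- 2)^-1 *: (e1 + k.+1%:R^-1 *: e2).

Lemma horocycle_dotp k : enorm (horocycle k) ^+ 2 = (1 + k.+1%:R ^- 2)^-1 /\
  dotp (horocycle k) e1 = (1 + k.+1%:R ^- 2)^-1.
Proof.
have k0 : 0 < k.+1%:R :> R by rewrite ltr0n.
have k2 : 0 < 1 + k.+1%:R ^- 2 :> R by rewrite ltr_wpDr // invr_ge0 sqr_ge0.
rewrite sqr_enorm !dotpE !dotp_delta !eqxx /= !(mulr0, mul0r, addr0, add0r, mulr1).
rewrite -!exprVn in k2 *; move: (k.+1%:R^-1) k2 => t t0.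
by split; first by field; rewrite gt_eqF.
Qed.

Lemma horocycle_depth k : depth (horocycle k) = (k.+1%:R ^+ 2 + 1)^-1.
Proof.
rewrite /depth (horocycle_dotp k).1.
have k0 : 0 < k.+1%:R :> R by rewrite ltr0n.
by move: (k.+1%:R) k0 => t t0; field; rewrite !gt_eqF ?addr_gt0 ?exprn_gt0.
Qed.

Lemma horocycle_hball k : hball R m.+2 (horocycle k).
Proof.
by rewrite /hball /= -depth_gt0 horocycle_depth invr_gt0 ltr_wpDl ?sqr_ge0.
Qed.

Lemma horocycle_horosphere k : enorm (horocycle k - e1) ^+ 2 = depth (horocycle k).
Proof.
rewrite sqr_enorm_sub /depth enorm_delta (horocycle_dotp k).1 (horocycle_dotp k).2.
by ring.
Qed.

Lemma horocycle_not_conical x : ~ conical_point (range horocycle) x.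
Proof.
apply: (@horosphere_not_conical _ _ _ e1).
  by move=> _ [k _ <-]; exact: horocycle_hball.
by move=> _ [k _ <-]; exact: horocycle_horosphere.
Qed.

Lemma horocycle_depth_to0 : depth_to0 horocycle.
Proof.
move=> e e0; exists (Num.truncn e^-1) => k Nk.
have D0 : 0 < k.+1%:R ^+ 2 + 1 :> R by rewrite ltr_wpDl ?sqr_ge0.
rewrite horocycle_depth invf_plt ?posrE //.
apply: lt_le_trans (truncnS_gt _) _.
have : (Num.truncn e^-1).+1%:R <= k.+1%:R :> R by rewrite ler_nat ltnS.
have : 1 <= k.+1%:R :> R by rewrite ler1n.
move: (k.+1%:R : R) ((Num.truncn e^-1).+1%:R : R) => s t s1 ts; nra.
Qed.

Lemma depth_neq0 (z : V) : depth z <= 1 / 2 -> z != 0.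
Proof. by apply: contraTneq => ->; rewrite /depth enorm0 expr0n /= -ltNge; lra. Qed.

(** With [z k] sent to the centre and [- z k / |z k|] to [e1], the images of a
    point tend to [e1] as long as the [z k] are not conical at it. *)
Lemma conical_divergence (E : set V) : E `<=` hball R m.+2 -> exists G,
  (forall k, mobius (G k) /\ orientation_preserving (G k)) /\
  conical_limit_set E = divergence_set G.
Proof.
move=> EB.
have [z' [z'0 z'E z'c]] := discretisation EB horocycle_depth_to0.
(* every other point is on the horocycle, so [e1] is the only possible limit *)
pose z k := if odd k then z' k./2 else horocycle k./2.
have z0 : depth_to0 z.
  move=> e e0; have [N1 h1] := z'0 _ e0; have [N2 h2] := horocycle_depth_to0 e0.
  exists (maxn N1 N2).*2 => k; rewrite -geq_half_double geq_max => /andP[k1 k2].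
  by rewrite /z; case: ifP => _; [exact: h1 | exact: h2].
have zE k : (exists j, z k = horocycle j) \/ E (z k) /\ depth (z k) <= 1 / 2.
  by rewrite /z; case: ifP => _; [exact: z'E | left; exists k./2].
have zb k : hball R m.+2 (z k).
  by case: (zE k) => [[j ->]|[/EB//]]; exact: horocycle_hball.
have zn k : z k != 0.
  apply: depth_neq0; case: (zE k) => [[j ->]|[]//]; rewrite horocycle_depth.
  rewrite div1r lef_pV2 ?posrE ?ltr_wpDl ?sqr_ge0 //.
  by rewrite lerD2r exprn_ege1 // ler1n.
have zc x : conical_point (range z) x <-> conical_point E x.
  split=> [cx|/z'c]; last first.
    apply: conical_pointS => _ [k _ <-]; exists k.*2.+1 => //.
    by rewrite /z /= odd_double /= uphalf_double.
  have [//|/horocycle_not_conical//] : conical_point E x \/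
      conical_point (range horocycle) x.
  apply: conical_pointU; apply: conical_pointS cx => _ [k _ <-].
  by case: (zE k) => [[j ->]|[Ez _]]; [right; exists j | left].
have e12 : dotp e1 e2 = 0 by rewrite dotp_delta.
have /choice[G hG] (k : nat) : exists G, [/\ mobius G, orientation_preserving G,
    G (z k) = 0 & G (- ((enorm (z k))^-1 *: z k)) = e1].
  exact: centering (zb k) (zn k) (enorm_delta _) (enorm_delta _) e12.
have mG k : mobius (G k) by have [] := hG k.
have Gz k : G k (z k) = 0 by have [] := hG k.
exists G; split; first by move=> k; have [] := hG k.
pose y k := - ((enorm (z k))^-1 *: z k).
have Gy k : G k (y k) = e1 by have [] := hG k.
have nz k : 0 < enorm (z k) by rewrite enorm_gt0.
have sy k : sphere R m.+2 (y k).
  by rewrite /sphere /= enormN enormZ ger0_norm ?invr_ge0 ?enorm_ge0 // mulVf ?gt_eqF.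
have zy k : 1 <= enorm (z k - y k).
  have -> : z k - y k = (1 + (enorm (z k))^-1) *: z k.
    by rewrite opprK scalerDl scale1r.
  rewrite enormZ ger0_norm ?addr_ge0 ?invr_ge0 ?enorm_ge0 // mulrDl mul1r.
  by rewrite mulVf ?gt_eqF // lerDr enorm_ge0.
have to_e1 x (h : nat -> nat) : sphere R m.+2 x -> (forall k, (k <= h k)%N) ->
    ~ conical_point (range (z \o h)) x -> G (h k) x @[k --> \oo] --> e1.
  move=> sx hk nc; apply/cvg_enormP => e e0; have ee : 0 < e / 2 by rewrite divr_gt0.
  have [N1 h1] := z0 _ ee.
  have zh0 : depth_to0 (z \o h).
    move=> d /z0[N hN]; exists N => k Nk; apply: hN; exact: leq_trans (hk k).
  have [N2 h2] := nonconical_ratio (fun k => zb (h k)) zh0 sx nc ee.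
  exists (maxn N1 N2) => k; rewrite geq_max => /andP[k1 k2].
  rewrite -(Gy (h k)).
  apply: le_lt_trans (mobius_chord_le (mG _) (zb _) (Gz _) sx (sy _)) _.
  have : cone_ratio (z (h k)) (y (h k)) <= depth (z (h k)).
    rewrite /cone_ratio ler_pdivrMr ?sphere_ball_neq //.
    by rewrite ler_peMr // ltW // hball_depth.
  by have := h1 _ (leq_trans k1 (hk k)); have := h2 _ k2; rewrite /=; lra.
apply/seteqP; split=> x; last first.
  move=> [sx nc]; apply/(conical_limit_setP x EB); split=> //; apply/zc.
  apply: contrapT => ncx; apply: nc; exists e1; first exact: enorm_delta.
  exact: (to_e1 x id).
move=> /(conical_limit_setP x EB)[sx /zc cx]; split=> // -[w _ Gw].
have we1 : w = e1.
  have Ge : G k.*2 x @[k --> \oo] --> e1.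
    apply: (to_e1 x double) => // [k|]; first by rewrite -addnn leq_addr.
    rewrite (_ : z \o double = horocycle); first exact: horocycle_not_conical.
    by apply/funext => k; rewrite /z /= odd_double doubleK.
  have Gw2 : G k.*2 x @[k --> \oo] --> w.
    apply/cvg_enormP => e e0; have [N hN] := (cvg_enormP _ _).1 Gw _ e0.
    by exists N => k Nk; apply: hN; rewrite -addnn (leq_trans Nk) ?leq_addr.
  exact: (cvg_unique (@norm_hausdorff _ _) Gw2 Ge).
have [M M0 hM] := conical_infinitely_often zb cx.
have Ce : cst e1 k @[k --> \oo] --> e1 by exact: cvg_cst.
apply: (cvg_apart (c := (4 * M)^-1) _ Gw Ce) we1 => [|N].
  by rewrite invr_gt0 mulr_gt0.
have M2 : 0 < (2 * M)^-1 by rewrite invr_gt0 mulr_gt0.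
have [N' hN'] := z0 _ M2.
have [k] := hM (maxn N N'); rewrite geq_max => /andP[Nk N'k] zx; exists k => //.
rewrite /cst -(Gy k) (mobius_chord_ratio (mG k) (zb k) (Gz k) sx (sy k)).
have px := sphere_ball_neq sx (zb k); have py := sphere_ball_neq (sy k) (zb k).
rewrite (_ : (4 * M)^-1 = M^-1 * 4^-1); last by rewrite invfM mulrC.
apply: ler_pM; rewrite ?invr_ge0 ?(ltW M0) //.
  by rewrite /cone_ratio ler_pdivlMr // mulrC ler_pdivrMr // mulrC.
have : enorm (z k - y k) <= 2 by exact: sphere_dist_le2.
have : 1 / 2 <= enorm (x - y k).
  have := enorm_triangle x (z k) (y k); have := zy k.
  have : M * depth (z k) < 1 / 2.
    have := hN' _ N'k; rewrite -[_^-1]mul1r ltr_pdivlMr ?mulr_gt0 // => h.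
    by lra.
  by lra.
move: (enorm (x - _)) (enorm (z k - _)) py => p q q0 p2 q2.
by rewrite ler_pdivlMr //; lra.
Qed.

End Construction.

Theorem proposition1p1 (R : realType) (m : nat) (hm : (1 <= m)%N)
    (A : set 'rV[R]_m.+1) (hA : A `<=` sphere R m.+1) :
  (exists G : nat -> 'rV[R]_m.+1 -> 'rV[R]_m.+1,
      (forall k, mobius (G k) /\ orientation_preserving (G k)) /\
      A = divergence_set G)
  <->
  (exists E : set 'rV[R]_m.+1,
      E `<=` hball R m.+1 /\ A = conical_limit_set E).
Proof.
split=> [[G [hG AG]]|[E [EB AE]]].
  have /choice[z hz] (k : nat) : exists z, hball R m.+1 z /\ G k z = 0.
    by have [z hz Gz] := mobius_zero (hG k).1; exists z.
  have [E [EB AE]] := divergence_conical (fun k => (hG k).1)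
    (fun k => (hz k).1) (fun k => (hz k).2).
  by exists E; rewrite AG.
case: m hm A hA E EB AE => // m' _ A _ E EB AE.
have [G [hG GE]] := conical_divergence EB.
by exists G; rewrite AE.
Qed.
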